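(* Let $(\mathfrak h,(H_i,L_i)_{i\in I})$ be a linear Coxeter system with linear Coxeter group $\mathcal W$, closed fundamental chamber $\overline C$ and Tits cone $X$. Let $Y\subseteq X$ be a $\mathcal W$-invariant convex subcone containing $0$, and let $R\in\Upsilon$. Then $$\mathrm{ri}(R)\cap\overline C=\dot{\bigcup_{J_f\subseteq\upsilon^*(R),\ (J_f)^0=J_f}}\ \mathrm{ri}(R)\cap F_{\upsilon_*(R)\cup J_f},$$ a disjoint union in which every set $\mathrm{ri}(R)\cap F_{\upsilon_*(R)\cup J_f}$ is nonempty, and for $J_f\subseteq\upsilon^*(R)$ with $(J_f)^0=J_f$ we have $$\mathrm{mid}_{J_f}\big(\mathrm{ri}(R\cap\overline C)\big)=\mathrm{mid}_{J_f}\big(\mathrm{ri}(R\cap\overline F_{\upsilon_*(R)})\big)=\mathrm{ri}(R)\cap F_{\upsilon_*(R)\cup J_f}.$$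
   Context: $\mathbb R^+=(0,\infty)$. A convex cone is a subset of a real vector space closed under addition and under multiplication by elements of $\mathbb R^+$. $\mathrm{ri}$ denotes the relative interior of a finite-dimensional convex set. For a convex cone $K$ containing $0$, a face of $K$ is a convex cone $F\subseteq K$ with $(K\setminus F)+K\subseteq K\setminus F$; $\mathrm{Fa}(K)$ is the set of nonempty faces, ordered by inclusion. Linear Coxeter systems. Let $\mathfrak h$ be a finite-dimensional real vector space, $n\ge1$, $I=\{1,\dots,n\}$. For a zero-based closed ray $H\subseteq\mathfrak h$ put $H^{\ge0}=\{\lambda\in\mathfrak h^*\mid\lambda(h)\ge0\ \forall h\in H\}$, $H^{>0}=\{\lambda\mid\lambda(h)>0\ \forall h\in H\setminus\{0\}\}$, $H^{=0}=\{\lambda\mid\lambda(h)=0\ \forall h\in H\}$. A linear Coxeter system $(\mathfrak h,(H_i,L_i)_{i\in I})$ consists of zero-based closed rays $H_i\subseteq\mathfrak h$, $L_i\subseteq\mathfrak h^*$ with $L_i\setminus\{0\}\subseteq H_i^{>0}$ such that: (1) the closed fundamental chamber $\overline C=\bigcap_{i\in I}H_i^{\ge0}$ spans $\mathfrak h^*$, and $\overline C\cap H_i^{=0}$, $i\in I$, are its pairwise different faces of codimension 1; (2) with $C=\bigcap_{i\in I}H_i^{>0}$ and $\mathcal W$ (the linear Coxeter group) the group generated by the reflections $\sigma_i$ on $\mathfrak h^*$ at the hyperplane $H_i^{=0}$ along the line $L_i\cup(-L_i)$, one has $\sigma C\cap C=\emptyset$ for all $\sigma\in\mathcal W\setminus\{1\}$.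 Then $(\mathcal W,(\sigma_i)_{i\in I})$ is a Coxeter system; $\mathcal W_J$ is the subgroup generated by $\sigma_j$, $j\in J$. The Tits cone is the convex cone $X=\bigcup_{\sigma\in\mathcal W}\sigma\overline C$. For each $i$ fix $h_i\in H_i$, $\alpha_i\in L_i$ with $\alpha_i(h_i)=2$ (nothing below depends on the choice), and set $A=(a_{ij})_{i,j\in I}$, $a_{ij}=\alpha_j(h_i)$. For $J\subseteq I$ set $F_J=\{\lambda\in\mathfrak h^*\mid\lambda(h_i)=0\ (i\in J),\ \lambda(h_i)>0\ (i\in I\setminus J)\}$ and $\overline F_J=\{\lambda\in\mathfrak h^*\mid\lambda(h_i)=0\ (i\in J),\ \lambda(h_i)\ge0\ (i\in I\setminus J)\}$. Sets $J,K\subseteq I$ are separated if $a_{jk}=0$ for all $j\in J,k\in K$; a nonempty set is connected if it is not a disjoint union of two nonempty separated subsets; connected components are the maximal nonempty connected subsets. A nonempty connected $J$ is of finite type if there is $u\in(\mathbb R^+)^J$ such that all entries of $(a_{ij})_{i,j\in J}\,u$ are positive. $J^0$ is the union of the finite type components of $J$ (so $J^0=J$ iff $J=\emptyset$ or all components of $J$ are of finite type; then $\mathcal W_J$ is finite). For $J_f\subseteq I$ with $(J_f)^0=J_f$ define the linear map $\mathrm{mid}_{J_f}:\mathfrak h^*\to\mathfrak h^*$, $\mathrm{mid}_{J_f}(\lambda)=\frac1{|\mathcal W_{J_f}|}\sum_{\sigma\in\mathcal W_{J_f}}\sigma\lambda$. $\Upsilon=\{R\in\mathrm{Fa}(Y)\mid\mathrm{ri}(R)\cap\overline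 C\ne\emptyset\}$. For $R\in\Upsilon$: $\upsilon(R)=\{i\in I\mid\sigma_iR=R\}$, $\upsilon_*(R)=\{i\in I\mid\sigma_i\text{ fixes }R\text{ pointwise}\}$, $\upsilon^*(R)=\upsilon(R)\setminus\upsilon_*(R)$ (equivalently $\{i\in I\mid L_i\subseteq R-R\}$). *)

(* Defs.v *)
From mathcomp Require Import all_boot all_order all_algebra finmap.
From mathcomp Require Import all_classical all_reals all_analysis.
Import Order.TTheory GRing.Theory Num.Theory.
Import numFieldNormedType.Exports.

Set Implicit Arguments.
Unset Strict Implicit.
Unset Printing Implicit Defensive.

Local Open Scope classical_set_scope.
Local Open Scope ring_scope.

(* * Convex geometry *)

Definition convex_cone (R : realType) (V : vectType R) (K : set V) : Prop :=
  (forall x y, K x -> K y -> K (x + y)) /\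
  (forall (r : R) x, 0 < r -> K x -> K (r *: x)).

(* [U] is the linear span of the (possibly infinite) set [S]. *)
Definition is_span (R : realType) (V : vectType R) (S : set V)
    (U : {vspace V}) : Prop :=
  (forall x, S x -> x \in U) /\
  (forall U' : {vspace V}, (forall x, S x -> x \in U') -> (U <= U')%VS).

Definition affine_hull (R : realType) (V : vectType R) (S : set V) : set V :=
  [set x | exists (m : nat) (t : 'I_m -> R) (p : 'I_m -> V),
     [/\ forall i, S (p i), \sum_i t i = 1 & x = \sum_i t i *: p i]].

(* A [vectType] carries no topology of its own; the topology used is that of
   the coordinate space ['rV[R]_n] with respect to a basis (in finite
   dimension, the choice of the basis is irrelevant). *)
Definition ri (R : realType) (V : vectType R) (S : set V) : set V :=
  [set x | S x /\
     \forall u \near passmx.rVof (vbasis fullv) x,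
       affine_hull S (passmx.vecof (vbasis fullv) u) -> S (passmx.vecof (vbasis fullv) u)].

Definition face (R : realType) (V : vectType R) (K F : set V) : Prop :=
  [/\ convex_cone F, F `<=` K &
      forall x y, (K `\` F) x -> K y -> (K `\` F) (x + y)].

Definition Fa (R : realType) (V : vectType R) (K : set V) : set (set V) :=
  [set F | face K F /\ F !=set0].

Definition codim1 (R : realType) (V : vectType R) (K F : set V) : Prop :=
  exists UK UF : {vspace V},
    [/\ is_span K UK, is_span F UF & \dim UK = (\dim UF).+1].

Definition closed_ray (R : realType) (V : vectType R) (S : set V) : Prop :=
  exists2 v : V, v != 0 & S = [set r *: v | r in [set r : R | 0 <= r]].

(* * Linear Coxeter systems *)

Definition ray_ge0 (R : realType) (h : vectType R) (H : set h) :
    set 'Hom(h, R^o) :=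
  [set l : 'Hom(h, R^o) | forall x, H x -> 0 <= (l x : R)].

Definition ray_gt0 (R : realType) (h : vectType R) (H : set h) :
    set 'Hom(h, R^o) :=
  [set l : 'Hom(h, R^o) | forall x, H x -> x != 0 -> 0 < (l x : R)].

Definition ray_eq0 (R : realType) (h : vectType R) (H : set h) :
    set 'Hom(h, R^o) :=
  [set l : 'Hom(h, R^o) | forall x, H x -> l x = 0].

Definition is_reflection (R : realType) (h : vectType R) (H : set h)
    (L : set 'Hom(h, R^o)) (s : 'End('Hom(h, R^o))) : Prop :=
  (forall l, ray_eq0 H l -> s l = l) /\ (forall a, L a -> s a = - a).

(* The reflection at [ray_eq0 H] along the line spanned by [L]; it exists and
   is unique as soon as [H], [L] are closed rays with
   [L `\ 0 `<=` ray_gt0 H]. *)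
Definition reflection (R : realType) (h : vectType R) (H : set h)
    (L : set 'Hom(h, R^o)) : 'End('Hom(h, R^o)) :=
  xget 0 (is_reflection H L).

(* [(f^-1)%VF] is the inverse of [f] when [f] is bijective, which is the only
   case used below. *)
Inductive generated (R : realType) (V : vectType R) (S : set 'End(V)) :
    set 'End(V) :=
| generated1 : generated S \1%VF
| generated_base f : S f -> generated S f
| generatedM f g : generated S f -> generated S g -> generated S (f \o g)%VF
| generatedV f : generated S f -> generated S (f^-1)%VF.

Definition parabolic (R : realType) (h : vectType R) (n : nat)
    (H : 'I_n -> set h) (L : 'I_n -> set 'Hom(h, R^o)) (J : {set 'I_n}) :
    set 'End('Hom(h, R^o)) :=
  generated [set reflection (H j) (L j) | j in [set j | j \in J]].

Definition coxeter_group (R : realType) (h : vectType R) (n : nat)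
    (H : 'I_n -> set h) (L : 'I_n -> set 'Hom(h, R^o)) :
    set 'End('Hom(h, R^o)) :=
  generated (range (fun i => reflection (H i) (L i))).

Definition chamber (R : realType) (h : vectType R) (n : nat)
    (H : 'I_n -> set h) : set 'Hom(h, R^o) :=
  \bigcap_(i in [set: 'I_n]) ray_gt0 (H i).

Definition closed_chamber (R : realType) (h : vectType R) (n : nat)
    (H : 'I_n -> set h) : set 'Hom(h, R^o) :=
  \bigcap_(i in [set: 'I_n]) ray_ge0 (H i).

Record linear_coxeter_system (R : realType) (h : vectType R) (n : nat)
    (H : 'I_n -> set h) (L : 'I_n -> set 'Hom(h, R^o)) : Prop :=
  LinearCoxeterSystem {
    lcs_rank : (1 <= n)%N;
    lcs_rayH : forall i, closed_ray (H i);
    lcs_rayL : forall i, closed_ray (L i);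
    lcs_pos : forall i, L i `\ 0 `<=` ray_gt0 (H i);
    lcs_span : is_span (closed_chamber H) fullv;
    lcs_face_inj : injective (fun i => closed_chamber H `&` ray_eq0 (H i));
    lcs_faceP : forall F : set 'Hom(h, R^o),
      (Fa (closed_chamber H) F /\ codim1 (closed_chamber H) F) <->
      (exists i, F = closed_chamber H `&` ray_eq0 (H i));
    lcs_disjoint : forall s, coxeter_group H L s -> s != \1%VF ->
      (s @` chamber H) `&` chamber H = set0 }.

Definition tits_cone (R : realType) (h : vectType R) (n : nat)
    (H : 'I_n -> set h) (L : 'I_n -> set 'Hom(h, R^o)) : set 'Hom(h, R^o) :=
  \bigcup_(s in coxeter_group H L) (s @` closed_chamber H).

(* * Facets *)

Definition facet (R : realType) (h : vectType R) (n : nat) (hh : 'I_n -> h)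
    (J : {set 'I_n}) : set 'Hom(h, R^o) :=
  [set l : 'Hom(h, R^o) | (forall i, i \in J -> l (hh i) = 0) /\
           (forall i, i \notin J -> 0 < (l (hh i) : R))].

Definition closed_facet (R : realType) (h : vectType R) (n : nat)
    (hh : 'I_n -> h) (J : {set 'I_n}) : set 'Hom(h, R^o) :=
  [set l : 'Hom(h, R^o) | (forall i, i \in J -> l (hh i) = 0) /\
           (forall i, i \notin J -> 0 <= (l (hh i) : R))].

(* * Types of subsets of the index set *)

Definition coxeter_mx (R : realType) (h : vectType R) (n : nat)
    (hh : 'I_n -> h) (alpha : 'I_n -> 'Hom(h, R^o)) : 'M[R]_n :=
  \matrix_(i, j) (alpha j (hh i) : R).

Definition separated_sets (R : realType) (n : nat) (A : 'M[R]_n)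
    (J K : {set 'I_n}) : Prop :=
  forall j k, j \in J -> k \in K -> A j k = 0.

Definition connected_set (R : realType) (n : nat) (A : 'M[R]_n)
    (J : {set 'I_n}) : Prop :=
  J != finset.set0 /\
  ~ exists J1 J2 : {set 'I_n},
      [/\ J1 != finset.set0, J2 != finset.set0, (J1 :&: J2)%SET = finset.set0,
          J = (J1 :|: J2)%SET & separated_sets A J1 J2].

Definition component (R : realType) (n : nat) (A : 'M[R]_n)
    (J K : {set 'I_n}) : Prop :=
  [/\ K \subset J, connected_set A K &
      forall K' : {set 'I_n}, K' \subset J -> connected_set A K' ->
        K \subset K' -> K' = K].

Definition finite_type (R : realType) (n : nat) (A : 'M[R]_n)
    (J : {set 'I_n}) : Prop :=
  exists u : 'I_n -> R, (forall j, j \in J -> 0 < u j) /\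
    (forall i, i \in J -> 0 < \sum_(j in J) A i j * u j).

(* The union [J^0] of the components of finite type of [J]. *)
Definition fin_part (R : realType) (n : nat) (A : 'M[R]_n)
    (J : {set 'I_n}) : {set 'I_n} :=
  finset (fun i => `[< exists K : {set 'I_n},
                         [/\ component A J K, finite_type A K & i \in K] >]).

(* The average over [parabolic H L J] when that group is finite; [fset_set]
   is the empty set on infinite sets. *)
Definition mid (R : realType) (h : vectType R) (n : nat)
    (H : 'I_n -> set h) (L : 'I_n -> set 'Hom(h, R^o)) (J : {set 'I_n})
    (l : 'Hom(h, R^o)) : 'Hom(h, R^o) :=
  (#|` fset_set (parabolic H L J)|%:R)^-1 *:
  \sum_(s <- fset_set (parabolic H L J)) s l.

(* * Faces of an invariant subcone *)

Definition Upsilon (R : realType) (h : vectType R) (n : nat)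
    (H : 'I_n -> set h) (Y : set 'Hom(h, R^o)) : set (set 'Hom(h, R^o)) :=
  [set F | Fa Y F /\ (ri F `&` closed_chamber H) !=set0].

Definition upsilon (R : realType) (h : vectType R) (n : nat)
    (H : 'I_n -> set h) (L : 'I_n -> set 'Hom(h, R^o))
    (F : set 'Hom(h, R^o)) : {set 'I_n} :=
  finset (fun i => `[< reflection (H i) (L i) @` F = F >]).

Definition upsilon_sub (R : realType) (h : vectType R) (n : nat)
    (H : 'I_n -> set h) (L : 'I_n -> set 'Hom(h, R^o))
    (F : set 'Hom(h, R^o)) : {set 'I_n} :=
  finset (fun i => `[< forall x, F x -> reflection (H i) (L i) x = x >]).

Definition upsilon_sup (R : realType) (h : vectType R) (n : nat)
    (H : 'I_n -> set h) (L : 'I_n -> set 'Hom(h, R^o))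
    (F : set 'Hom(h, R^o)) : {set 'I_n} :=
  (upsilon H L F :\: upsilon_sub H L F)%SET.

(* Main.v *)
(* For x in ri R meeting the closed chamber, put J = {i | x(h_i) = 0} minus
   upsilon_sub(R).  Were J not of finite type, the alternative for matrices with
   nonpositive off-diagonal entries would give y >= 0, y <> 0, supported on J with
   y A <= 0.  The functional xi = sum_j y_j h_j is then nonnegative on the Tits
   cone, and vanishes only where all h_j with y_j <> 0 vanish: both follow by
   induction along a word descending to the closed chamber, provided by the
   exchange property.  As xi(x) = 0 and x is a relative interior point, xi
   vanishes on R, and so do these h_j, contradicting J disjoint from upsilon_sub(R).
   Conversely, let J be of finite type, with u > 0 and A_J u > 0.  Moving along
   sum_j u_j alpha_j, a direction of the span of R, pushes a point of ri(R) off the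
   walls in J without leaving ri(R), and mid_J moves it back.  On points with no
   further vanishing h_i than those of upsilon_sub(R), mid_J subtracts a nonnegative
   combination of the alpha_j, by monotonicity of A_J, so no other h_i vanishes.
   Finiteness of W_J: a coefficient vector y >= 0 all of whose W_J-translates are
   >= 0 must be 0, because greedy reflections contract the cone of such vectors to
   0 while having determinant 1 or -1 on its span.  By compactness, finitely many
   words turn every positive root negative; hence there are finitely many rays of
   roots, and an element of W_J is determined by its signs on them. *)
Require Import Defs.
From HB Require Import structures.
From mathcomp Require Import all_boot all_order all_algebra perm finmap.
From mathcomp Require Import all_classical all_reals all_analysis.
From mathcomp Require Import ring lra.
Import Order.TTheory GRing.Theory Num.Theory.
Import numFieldNormedType.Exports.

Set Implicit Arguments.
Unset Strict Implicit.
Unset Printing Implicit Defensive.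

Local Open Scope classical_set_scope.
Local Open Scope ring_scope.

(** * Matrices with nonpositive off-diagonal entries *)

(** If [e * (1 + S) <= 1], with [S] the sum of the [|c i| / b i], then [e * |c i| < b i] for all [i]
    at once. *)
Lemma small_pos (R : realType) (I : finType) (P : pred I) (b c : I -> R) :
  (forall i, P i -> 0 < b i) ->
  exists2 e0 : R, 0 < e0 &
    forall e, 0 < e -> e <= e0 -> forall i, P i -> 0 < b i + e * c i.
Proof.
move=> b0; pose S := \sum_(i | P i) `|c i| / b i.
have t0 i : P i -> 0 <= `|c i| / b i by move=> /b0/ltW ?; rewrite divr_ge0.
have S0 : 0 <= S by apply: sumr_ge0.
exists (1 + S)^-1; first by rewrite invr_gt0; lra.
move=> e e_gt0 eS i Pi; have bi := b0 _ Pi.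
have ciS : `|c i| / b i <= S.
  by rewrite /S (bigD1 i)//= lerDl sumr_ge0// => j /andP[/t0].
have eS1 : e * (1 + S) <= 1 by rewrite -ler_pdivlMr ?div1r//; lra.
have : e * `|c i| < b i.
  rewrite -[ltRHS]mul1r -ltr_pdivrMr// -mulrA.
  by apply: le_lt_trans (_ : e * S < _); [rewrite ler_wpM2l// ltW | nra].
have := ler_norm (- (e * c i)); rewrite normrN normrM (gtr0_norm e_gt0); lra.
Qed.

Section ZMatrix.
Variables (R : realType) (n : nat).
Implicit Types (A : 'M[R]_n) (J K : {set 'I_n}).

(* Stiemke/Ville alternative; for matrices with nonpositive off-diagonal entries
   it follows by eliminating one index at a time. *)
Lemma finite_type_alternative A J :
  (forall i j, i != j -> A i j <= 0) ->
  finite_type A J \/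
  exists y : 'I_n -> R,
    [/\ forall i, 0 <= y i, forall i, i \notin J -> y i = 0, exists i, y i != 0 &
        forall j, j \in J -> \sum_(i in J) y i * A i j <= 0].
Proof.
move: {2}#|J| (erefl #|J|) => m; elim: m J A => [|m IH] J A cJ An.
  left; exists (fun=> 1); split=> // i; move/eqP: cJ; rewrite cards_eq0 => /eqP->.
  by rewrite inE.
have [i iJ] : exists i, i \in J by apply/set0Pn; rewrite -card_gt0 cJ.
have [Aii|Aii] := leP (A i i) 0.
  right; exists (fun j => (j == i)%:R); split.
  - by move=> j; rewrite ler0n.
  - by move=> j; case: eqP => // ->; rewrite iJ.
  - by exists i; rewrite eqxx oner_eq0.
  - move=> j _; rewrite (bigD1 i)//= eqxx mul1r big1 ?addr0 => [|k /andP[_ /negPf->]].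
      by have [<-//|/An] := eqVneq i j.
    by rewrite mul0r.
pose J' := (J :\ i)%SET.
have cJ' : #|J'| = m by move: cJ; rewrite (cardsD1 i) iJ => -[].
(* Schur complement of [A] at the pivot [A i i]; off the diagonal it stays nonpositive because
   [A k i * A i l >= 0]. *)
pose B : 'M[R]_n := \matrix_(k, l) if (k == i) || (l == i) then 0
                      else A k l - A k i * A i l / A i i.
have J'i k : k \in J' -> (k == i) = false by rewrite !inE => /andP[/negPf].
have sumJ (f : 'I_n -> R) : \sum_(k in J) f k = f i + \sum_(k in J') f k.
  rewrite (bigD1 i)//=; congr (_ + _); apply: eq_bigl => k.
  by rewrite !inE andbC.
case: (IH J' B cJ').
- move=> k l kl; rewrite mxE; case: eqVneq => //= ki; case: eqVneq => //= li.
  rewrite subr_le0; apply: le_trans (An _ _ kl) _.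
  rewrite divr_ge0 ?(ltW Aii)//.
  by rewrite mulr_le0 ?An// eq_sym.
- move=> [u [u0 Bu]]; left.
  pose b k := \sum_(l in J') B k l * u l.
  have [e e0 /(_ _ e0 (lexx _)) He] := small_pos (fun k => A k i / A i i) Bu.
  (* The value at [i] makes row [i] sum to [e]; the other rows become those of [B u] plus
     [e * (A k i / A i i)], still positive for small [e]. *)
  exists (fun j => if j == i then (e - \sum_(l in J') A i l * u l) / A i i else u j).
  split=> [j jJ|k kJ].
    case: eqVneq => [_|ji]; last by apply: u0; rewrite !inE ji jJ.
    rewrite divr_gt0// subr_gt0; apply: le_lt_trans e0.
    rewrite -oppr_ge0 -sumrN sumr_ge0// => l lJ.
    rewrite -mulNr mulr_ge0// ?oppr_ge0 ?An ?(ltW (u0 _ lJ))//.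
    by rewrite eq_sym J'i.
  rewrite sumJ eqxx.
  rewrite [X in _ + X](eq_bigr (fun l => A k l * u l)); last by move=> l /J'i /= ->.
  have [->|ki] := eqVneq k i.
    by rewrite mulrCA divff ?mulr1 ?subrK ?gt_eqF.
  have kJ' : k \in J' by rewrite !inE ki kJ.
  have := He _ kJ'.
  rewrite (eq_bigr (fun l => A k l * u l - A k i / A i i * (A i l * u l))).
    rewrite sumrB -mulr_sumr; set s1 := \sum_(l in J') _; set s2 := \sum_(l in J') _.
    by congr (0 < _); ring.
  by move=> l lJ; rewrite mxE (negPf ki) J'i//=; ring.
- move=> [y [y0 yJ [k yk] yB]]; right.
  pose s := \sum_(l in J') y l * A l i.
  (* The value at [i] makes the sum for column [i] vanish and turns the other column sums into those
     of [B]. *)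
  exists (fun j => if j == i then - s / A i i else y j); split.
  + move=> j; case: eqP => // _; rewrite mulNr -mulrN mulr_le0 ?oppr_le0 ?invr_ge0 ?(ltW Aii)//.
    rewrite -oppr_ge0 -sumrN sumr_ge0// => l /J'i li.
    by rewrite -mulrN mulr_ge0// oppr_ge0 An ?li.
  + move=> j; case: eqVneq => [->|ji]; first by rewrite iJ.
    by move=> jJ; apply: yJ; rewrite !inE ji.
  + exists k; case: (eqVneq k i) => // ki; move: yk.
    by rewrite yJ ?eqxx// !inE ki eqxx.
  + move=> j jJ; rewrite sumJ eqxx.
    rewrite [X in _ + X](eq_bigr (fun l => y l * A l j)); last by move=> l /J'i /= ->.
    have [->|ji] := eqVneq j i.
      by rewrite -mulrA mulVf ?gt_eqF// mulr1 -/s addNr.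
    have jJ' : j \in J' by rewrite !inE ji jJ.
    apply: le_trans (yB _ jJ').
    rewrite [leRHS](eq_bigr (fun l => y l * A l j - A i j / A i i * (y l * A l i))).
      by rewrite sumrB -mulr_sumr -/s addrC mulrAC lerD2l -mulrA mulNr [s * _]mulrC.
    by move=> l lJ; rewrite mxE (negPf ji) J'i//=; ring.
Qed.

(** * Monotonicity and solvability in finite type *)

Section Monotone.
Variables (A : 'M[R]_n) (J : {set 'I_n}).
Hypothesis Aoff : forall i j, i != j -> A i j <= 0.
Hypothesis Jfin : finite_type A J.

(** Minimum principle: at an index [k] where [c / u] attains its minimum [t], row [k] of
    [A (c - t u)] is nonpositive, whereas [t < 0] would make it positive. *)
Lemma finite_type_monotone (c : 'I_n -> R) :
  (forall i, i \in J -> 0 <= \sum_(j in J) A i j * c j) ->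
  forall j, j \in J -> 0 <= c j.
Proof.
move=> Ac j0 j0J; case: Jfin => u [u0 Au]; rewrite leNgt; apply/negP => cj0.
have [k kJ kmin] : exists2 k, k \in J & forall j, j \in J -> c k / u k <= c j / u j.
  by case: (Order.TotalTheory.arg_minP (fun k => c k / u k) j0J) => k; exists k.
pose t := c k / u k.
have t0 : t < 0.
  apply: le_lt_trans (kmin _ j0J) _.
  by rewrite pmulr_llt0// invr_gt0 u0.
have : \sum_(j in J) A k j * (c j - t * u j) <= 0.
  apply: sumr_le0 => j jJ; have [<-|kj] := eqVneq k j.
    by rewrite /t divfK ?subrr ?mulr0// gt_eqF ?u0.
  rewrite mulr_le0_ge0 ?Aoff// subr_ge0 -ler_pdivlMr ?u0//.
  exact: kmin.
rewrite (eq_bigr (fun j => A k j * c j - t * (A k j * u j))) => [|j _]; last by ring.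
rewrite sumrB -mulr_sumr; have := Ac _ kJ; have := Au _ kJ.
set a := \sum_(j in J) _; set b := \sum_(j in J) _; nra.
Qed.

Lemma finite_type_solve (z : 'I_n -> R) :
  exists c : 'I_n -> R, forall i, i \in J -> \sum_(j in J) A i j * c j = z i.
Proof.
(* The block on [J], completed by the identity; monotonicity applied to [v] and [- v] makes it
   injective, hence invertible. *)
pose B : 'M[R]_n := \matrix_(i, j)
  if (i \in J) && (j \in J) then A i j else (i == j)%:R.
have BE (c : 'cV[R]_n) i : (B *m c) i 0 =
    if i \in J then \sum_(j in J) A i j * c j 0 else c i 0.
  rewrite mxE; case: ifPn => iJ.
    rewrite [RHS]big_mkcond; apply: eq_bigr => j _; rewrite mxE iJ /=.
    case: ifPn => jJ //; case: eqP => [ij|_]; last by rewrite mul0r.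
    by move: jJ; rewrite -ij iJ.
  rewrite (bigD1 i)//= mxE (negPf iJ)/= eqxx mul1r big1 ?addr0 => [//|j ji].
  by rewrite mxE (negPf iJ)/= eq_sym (negPf ji) mul0r.
have B_unit : B \in unitmx.
  rewrite -unitmx_tr -row_free_unit -kermx_eq0; apply/rowV0P => v /sub_kermxP vB.
  have Bv : B *m v^T = 0 by apply: trmx_inj; rewrite trmx_mul trmxK trmx0.
  have v0 i : v 0 i = 0.
    have [iJ|iJ] := boolP (i \in J); last first.
      by have := BE v^T i; rewrite Bv (negPf iJ) !mxE.
    have Av k : k \in J -> \sum_(j in J) A k j * v 0 j = 0.
      move=> kJ; have := BE v^T k; rewrite Bv kJ mxE => /esym.
      by under eq_bigr do rewrite mxE.
    apply/eqP; rewrite eq_le; apply/andP; split.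
      rewrite -oppr_ge0; apply: (@finite_type_monotone (fun i => - v 0 i)) => // k kJ.
      by under eq_bigr do rewrite mulrN; rewrite sumrN Av// oppr0.
    by apply: (@finite_type_monotone (fun i => v 0 i)) => // k kJ; rewrite Av.
  by apply/rowP => i; rewrite v0 mxE.
exists (fun j => (invmx B *m \col_i z i) j 0) => i iJ.
have := BE (invmx B *m \col_i z i) i.
by rewrite mulKVmx// iJ mxE => <-.
Qed.

End Monotone.

(** * Connected components and the finite part of an index set *)

Section FinPart.
Variables (A : 'M[R]_n) (J : {set 'I_n}).
Hypothesis Aoff : forall i j, i != j -> A i j <= 0.
Hypothesis A0 : forall i j, A i j = 0 -> A j i = 0.

Lemma connected_set1 i : connected_set A [set i]%SET.
Proof.
split; first by apply/set0Pn; exists i; rewrite inE.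
move=> [J1 [J2 [/set0Pn[a aJ1] /set0Pn[b bJ2] /setP J12 iJ _]]].
have ai : a = i by apply/set1P; rewrite iJ inE aJ1.
have bi : b = i by apply/set1P; rewrite iJ inE bJ2 orbT.
by have := J12 i; rewrite !inE -{1}ai aJ1 -bi bJ2.
Qed.

Lemma separated_setsC J1 J2 : separated_sets A J1 J2 -> separated_sets A J2 J1.
Proof. by move=> s j k jJ kJ; apply/A0/s. Qed.

Lemma connected_separatedU K J1 J2 : connected_set A K -> K \subset (J1 :|: J2)%SET ->
  (J1 :&: J2)%SET = finset.set0 -> separated_sets A J1 J2 -> K \subset J1 \/ K \subset J2.
Proof.
move=> [K0 Kc] KJ J12 s.
have [K1|K1] := eqVneq (K :&: J1)%SET finset.set0.
  right; apply/fintype.subsetP => k kK; have := fintype.subsetP KJ _ kK; rewrite inE => /orP[kJ|//].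
  by move/setP: K1 => /(_ k); rewrite !inE kK kJ.
have [K2|K2] := eqVneq (K :&: J2)%SET finset.set0.
  left; apply/fintype.subsetP => k kK; have := fintype.subsetP KJ _ kK; rewrite inE => /orP[//|kJ].
  by move/setP: K2 => /(_ k); rewrite !inE kK kJ.
exfalso; apply: Kc; exists (K :&: J1)%SET, (K :&: J2)%SET; split => //.
- apply/setP => k; rewrite !inE; apply/negP => /andP[/andP[_ k1] /andP[_ k2]].
  by have /setP/(_ k) := J12; rewrite !inE k1 k2.
- by rewrite -finset.setIUr; apply/esym/finset.setIidPl.
- by move=> j k; rewrite !inE => /andP[_ jJ] /andP[_ kJ]; exact: s.
Qed.

Lemma connected_setU K1 K2 : connected_set A K1 -> connected_set A K2 ->
  ~ separated_sets A K1 K2 -> connected_set A (K1 :|: K2)%SET.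
Proof.
move=> c1 c2 ns; split.
  by case: c1 => /set0Pn[k kK] _; apply/set0Pn; exists k; rewrite inE kK.
move=> [J1 [J2 [J10 J20 J12 E s]]].
have s1 : K1 \subset (J1 :|: J2)%SET by rewrite -E finset.subsetUl.
have s2 : K2 \subset (J1 :|: J2)%SET by rewrite -E finset.subsetUr.
have sJ12 : (J1 \subset (K1 :|: K2)%SET) /\ (J2 \subset (K1 :|: K2)%SET).
  by rewrite E finset.subsetUl finset.subsetUr.
have [h1|h1] := connected_separatedU c1 s1 J12 s;
have [h2|h2] := connected_separatedU c2 s2 J12 s.
- have : J2 \subset J1 by apply: fintype.subset_trans sJ12.2 _; rewrite finset.subUset h1.
  move=> /fintype.subsetP J21; case/set0Pn: J20 => k k2.
  by have /setP/(_ k) := J12; rewrite !inE k2 J21.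
- by apply: ns => j k /(fintype.subsetP h1) j1 /(fintype.subsetP h2) k2; exact: s.
- apply: ns => j k /(fintype.subsetP h1) j1 /(fintype.subsetP h2) k2.
  by apply: separated_setsC j1 k2.
- have : J1 \subset J2 by apply: fintype.subset_trans sJ12.1 _; rewrite finset.subUset h1.
  move=> /fintype.subsetP J21; case/set0Pn: J10 => k k2.
  by have /setP/(_ k) := J12; rewrite !inE k2 J21.
Qed.

Lemma component_exists i : i \in J -> exists2 K, component A J K & i \in K.
Proof.
move=> iJ.
pose P (K : {set 'I_n}) := `[< [/\ K \subset J, connected_set A K & i \in K] >].
have P1 : P [set i]%SET.
  apply/asboolP; split; [by rewrite finset.sub1set | exact: connected_set1 | by rewrite inE].
case: (@arg_maxnP _ _ P (fun K => #|K|) P1) => K /asboolP[KJ Kc iK] Kmax.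
exists K => //; split => // K' K'J K'c KK'.
apply/esym/eqP; rewrite eqEcard KK'; apply: Kmax; apply/asboolP; split => //.
exact: (fintype.subsetP KK').
Qed.

(** Otherwise the union would be connected, and maximality would make both components equal to
    it. *)
Lemma components_separated K1 K2 : component A J K1 -> component A J K2 ->
  K1 != K2 -> separated_sets A K1 K2.
Proof.
move=> [K1J K1c K1max] [K2J K2c K2max] /eqP; apply: contra_notP => ns.
have c := connected_setU K1c K2c ns.
have UJ : (K1 :|: K2)%SET \subset J by rewrite finset.subUset K1J.
rewrite -(K1max _ UJ c (finset.subsetUl _ _)).
by rewrite -{2}(K2max _ UJ c (finset.subsetUr _ _)).
Qed.

Lemma component_eq K1 K2 i : A i i != 0 -> component A J K1 -> component A J K2 ->
  i \in K1 -> i \in K2 -> K1 = K2.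
Proof.
move=> Aii c1 c2 i1 i2; apply/eqP; apply: contraNT Aii => K12.
by apply/eqP/(components_separated c1 c2 K12).
Qed.

Lemma finite_type_sub K : K \subset J -> finite_type A J -> finite_type A K.
Proof.
move=> KJ [u [u0 Au]]; exists u; split=> [j /(fintype.subsetP KJ)/u0//|i iK].
have iJ := fintype.subsetP KJ _ iK.
apply: lt_le_trans (Au _ iJ) _.
rewrite (big_setID K)/=.
have /finset.setIidPr -> := KJ.
rewrite gerDl; apply: sumr_le0 => j; rewrite inE => /andP[jK jJ].
by rewrite mulr_le0_ge0 ?(ltW (u0 _ jJ))// Aoff//; apply: contraNneq jK => <-.
Qed.

(** Positive vectors of the components glue, since entries between distinct components vanish;
    conversely, passing to a component only drops nonpositive off-diagonal terms. *)
Lemma fin_partP : (forall i, A i i != 0) -> fin_part A J = J <-> finite_type A J.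
Proof.
move=> Aii; split=> [E|Jfin]; last first.
  apply/setP => i; rewrite inE; apply/asboolP/idP.
    by move=> [K [[KJ _ _] _ iK]]; exact: (fintype.subsetP KJ).
  move=> iJ; have [K Kc iK] := component_exists iJ; exists K; split => //.
  by apply: finite_type_sub Jfin; case: Kc.
have ex i : exists Ku : {set 'I_n} * ('I_n -> R), i \in J ->
    [/\ component A J Ku.1, i \in Ku.1, forall j, j \in Ku.1 -> 0 < Ku.2 j &
        forall k, k \in Ku.1 -> 0 < \sum_(j in Ku.1) A k j * Ku.2 j].
  have [iJ|iJ] := boolP (i \in J); last by exists (finset.set0, fun=> 0).
  move: iJ; rewrite -{1}E inE => /asboolP[K [Kc [u [u0 Au]] iK]].
  by exists (K, u).
have [f fP] := choice ex.
(* The vector is chosen per component, so that all indices of one component use the same one. *)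
have exg (K : {set 'I_n}) : exists gK : 'I_n -> R, component A J K ->
    (forall j, j \in K -> 0 < gK j) /\
    (forall k, k \in K -> 0 < \sum_(j in K) A k j * gK j).
  have [Kc|] := pselect (component A J K); last by exists (fun=> 0).
  have [/set0Pn[i iK] _] : connected_set A K by case: Kc.
  have iJ : i \in J by case: Kc => /fintype.subsetP/(_ _ iK).
  have [c1 i1 u0 Au] := fP _ iJ.
  by rewrite (component_eq (Aii i) Kc c1 iK i1); exists (f i).2.
have [g gP] := choice exg.
exists (fun j => g (f j).1 j); split=> [j jJ|i iJ].
  by have [c1 i1 _ _] := fP _ jJ; exact: (gP _ c1).1.
have [c1 i1 _ _] := fP _ iJ.
have KJ : (f i).1 \subset J by case: c1.
rewrite (big_setID (f i).1)/=.
have /finset.setIidPr -> := KJ.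
rewrite [X in _ + X]big1 ?addr0 => [|j]; last first.
  rewrite inE => /andP[jK jJ]; have [c2 j2 _ _] := fP _ jJ.
  rewrite (components_separated c1 c2) ?mul0r//.
  by apply: contraNneq jK => ->.
rewrite (eq_bigr (fun j => A i j * g (f i).1 j)); first exact: (gP _ c1).2.
move=> j jK; have jJ := fintype.subsetP KJ _ jK; have [c2 j2 _ _] := fP _ jJ.
by rewrite (component_eq (Aii j) c1 c2 jK j2).
Qed.

End FinPart.
End ZMatrix.

(** * Reflection groups and the Tits cone *)

(** If [f x > 0 > f y], the positive combination [f x *: y - f y *: x] is a point of [D] where [f]
    vanishes. *)
Lemma convex_sign (R : realType) (V : lmodType R) (D : V -> Prop) (f : {scalar V}) :
  (forall x y, D x -> D y -> D (x + y)) -> (forall c x, 0 < c -> D x -> D (c *: x)) ->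
  (forall x, D x -> f x <> 0) -> forall x y, D x -> D y -> 0 < f x -> 0 < f y.
Proof.
move=> DD DZ Df x y Dx Dy fx; rewrite ltNge; apply/negP => fy.
have {}fy : f y < 0 by rewrite lt_neqAle fy andbT; apply/eqP/Df.
apply: (Df (f x *: y + (- f y) *: x)).
  by apply: DD; apply: DZ => //; rewrite oppr_gt0.
by rewrite linearD !linearZ/= mulNr mulrC subrr.
Qed.

Section Reflections.
Variables (R : realType) (V : lmodType R) (n : nat).
Variables (e : 'I_n -> {scalar V}) (a : 'I_n -> V).

Definition simple_refl i (x : V) : V := x - e i x *: a i.

Lemma refl_linear i : linear (simple_refl i).
Proof.
move=> c x y; rewrite /simple_refl linearP/= scalerBr scalerDl opprD scalerA.
by rewrite addrACA.
Qed.
HB.instance Definition _ i := GRing.isLinear.Build R V V *:%R (simple_refl i) (refl_linear i).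

Definition word_act (w : seq 'I_n) (x : V) : V := foldr simple_refl x w.

Lemma act_linear w : linear (word_act w).
Proof. by elim: w => [//|i w IH] c x y /=; rewrite IH linearP. Qed.
HB.instance Definition _ w := GRing.isLinear.Build R V V *:%R (word_act w) (act_linear w).

Lemma act_cat w1 w2 x : word_act (w1 ++ w2) x = word_act w1 (word_act w2 x).
Proof. exact: foldr_cat. Qed.

Lemma act_rcons w i x : word_act (rcons w i) x = word_act w (simple_refl i x).
Proof. by rewrite -cats1 act_cat. Qed.

Hypothesis ea : forall i, e i (a i) = 2.

Lemma evalZ i c x : e i (c *: x) = c * e i x.
Proof. by rewrite linearZ. Qed.

Lemma eval_refl i j x : e i (simple_refl j x) = e i x - e j x * e i (a j).
Proof. by rewrite /simple_refl linearB evalZ. Qed.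

Lemma eval_refl_id i x : e i (simple_refl i x) = - e i x.
Proof. by rewrite eval_refl ea; ring. Qed.

Lemma reflK i : involutive (simple_refl i).
Proof. by move=> x; rewrite {1}/simple_refl eval_refl_id scaleNr opprK subrK. Qed.

Lemma refl_root i : simple_refl i (a i) = - a i.
Proof. by rewrite /simple_refl ea scaler_nat mulr2n opprD addNKr. Qed.

Lemma refl_id i x : e i x = 0 -> simple_refl i x = x.
Proof. by rewrite /simple_refl => ->; rewrite scale0r subr0. Qed.

Lemma root_neq0 i : a i <> 0.
Proof. by move=> a0; have := ea i; rewrite a0 linear0; lra. Qed.

Lemma refl_idE i x : simple_refl i x = x -> e i x = 0.
Proof.
move=> xE; have /eqP : e i x *: a i = 0.
  by rewrite -[LHS](subKr x) -/(simple_refl i x) xE subrr.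
by rewrite scaler_eq0 => /orP[] /eqP // /root_neq0.
Qed.

Lemma act_revK w : cancel (word_act w) (word_act (rev w)).
Proof.
by elim: w => [//|i w IH] x; rewrite rev_cons act_rcons /= reflK.
Qed.

Lemma act_Krev w : cancel (word_act (rev w)) (word_act w).
Proof. by move=> x; rewrite -{1}(revK w) act_revK. Qed.

End Reflections.

Lemma ge0_of_pos_perturb (R : realType) (b c : R) :
  (forall eps : R, 0 < eps -> 0 <= b + eps * c) -> 0 <= b.
Proof.
move=> H; rewrite leNgt; apply/negP => b0.
have /H : 0 < - b / (2 * (`|c| + 1)).
  by rewrite divr_gt0 ?oppr_gt0// mulr_gt0// ltr_wpDl.
set t := _ / _; have tE : t * (`|c| + 1) = - b / 2.
  by rewrite /t; field; rewrite gt_eqF// ltr_wpDl.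
have t0 : 0 < t by rewrite divr_gt0 ?oppr_gt0// mulr_gt0// ltr_wpDl.
have := ler_norm c; nra.
Qed.

(** * Root data: walls, exchange and the Tits cone *)

Section RootDatum.
Variables (R : realType) (V : lmodType R) (n : nat).
Variables (e : 'I_n -> {scalar V}) (a : 'I_n -> V).

Definition in_chamber (x : V) := forall i, 0 < e i x.
Definition in_closed_chamber (x : V) := forall i, 0 <= e i x.

(** Abstract form of a linear Coxeter system, with disjointness of chambers stated for words instead
    of group elements. *)
Record root_datum : Prop := RootDatum {
  rd_two : forall i, e i (a i) = 2;
  rd_chamber : exists x, in_chamber x;
  rd_wall : forall i, exists2 p, e i p = 0 & forall k, k != i -> 0 < e k p;
  rd_disjoint : forall w x, in_chamber x -> in_chamber (word_act e a w x) ->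
    forall y, word_act e a w y = y }.

Local Notation act := (word_act e a).
Local Notation refl := (simple_refl e a).
Local Notation Ch := in_chamber.
Local Notation Chb := in_closed_chamber.

Hypothesis rd : root_datum.
Let ea := rd_two rd.

Lemma chamberD x y : Ch x -> Ch y -> Ch (x + y).
Proof. by move=> Cx Cy i; rewrite linearD addr_gt0. Qed.

Lemma chamberZ c x : 0 < c -> Ch x -> Ch (c *: x).
Proof. by move=> c0 Cx i; rewrite evalZ mulr_gt0. Qed.

Lemma closed_chamberD x y : Chb x -> Ch y -> Ch (x + y).
Proof. by move=> Cx Cy i; rewrite linearD ltr_wpDl. Qed.

Lemma conjugate_neq1 w i : ~ (forall y, act (rev w ++ i :: w) y = y).
Proof.
move=> /(_ (act (rev w) (a i))); rewrite act_cat /= act_Krev// refl_root// linearN/=.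
move=> /(congr1 (act w)); rewrite linearN/= act_Krev// => aN.
have := ea i; rewrite -aN linearN/= ea; lra.
Qed.

(* If [act w x] lies on the wall of [i], then [w^-1 s_i w] fixes [x]. *)
Lemma act_off_wall w i x : Ch x -> e i (act w x) <> 0.
Proof.
move=> Cx wx0; apply: (@conjugate_neq1 w i); apply: (rd_disjoint rd Cx).
by rewrite act_cat /= refl_id// act_revK.
Qed.

(** The chamber is convex and [e i \o act w] has no zero on it. This is the dichotomy between
    positive and negative roots. *)
Lemma act_side w i : (forall x, Ch x -> 0 < e i (act w x)) \/
                     (forall x, Ch x -> e i (act w x) < 0).
Proof.
have [d Cd] := rd_chamber rd.
have [dp|dn] := ltP 0 (e i (act w d)).
  left=> x Cx.
  exact: (@convex_sign _ _ Ch (e i \o act w) chamberD chamberZ (fun z => @act_off_wall w i z) d x).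
right=> x Cx; rewrite lt_neqAle; apply/andP; split.
  by apply/eqP/act_off_wall.
rewrite leNgt; apply/negP => xp; move: dn; rewrite leNgt => /negP; apply.
exact: (@convex_sign _ _ Ch (e i \o act w) chamberD chamberZ (fun z => @act_off_wall w i z) x d).
Qed.

Lemma act_side_pos w i x : (forall x, Ch x -> 0 < e i (act w x)) -> Chb x ->
  0 <= e i (act w x).
Proof.
have [d Cd] := rd_chamber rd => H Cx.
apply: (@ge0_of_pos_perturb _ _ (e i (act w d))) => eps eps0.
by rewrite -evalZ -!linearD/= -linearZ/= -linearD ltW// H//; apply/closed_chamberD/chamberZ.
Qed.

Lemma act_side_neg w i x : (forall x, Ch x -> e i (act w x) < 0) -> Chb x ->
  e i (act w x) <= 0.
Proof.
have [d Cd] := rd_chamber rd => H Cx; rewrite -oppr_ge0.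
apply: (@ge0_of_pos_perturb _ _ (- e i (act w d))) => eps eps0.
rewrite mulrN -opprD oppr_ge0.
by rewrite -evalZ -!linearD/= -linearZ/= -linearD ltW// H//; apply/closed_chamberD/chamberZ.
Qed.

Lemma wall_closed p i : e i p = 0 -> (forall k, k != i -> 0 < e k p) -> Chb p.
Proof. by move=> p0 pp k; have [->|/pp/ltW//] := eqVneq k i; rewrite p0. Qed.

(** The functional [e i \o act [:: j]] has constant sign on the closed chamber; it is positive at
    the wall point of [j] and equals [- e j p * e i (a j)] at the wall point [p] of [i]. *)
Lemma cartan_offdiag_le0 i j : i != j -> e i (a j) <= 0.
Proof.
move=> ij; have [p p0 pp] := rd_wall rd i; have [q q0 qp] := rd_wall rd j.
have Cp := wall_closed p0 pp; have Cq := wall_closed q0 qp.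
have [H|H] := act_side [:: j] i.
  have := act_side_pos H Cp; rewrite /= eval_refl p0 sub0r oppr_ge0.
  by rewrite pmulr_rle0// pp// eq_sym.
have := act_side_neg H Cq; rewrite /= refl_id//.
by rewrite leNgt qp.
Qed.

(** If [e i (a j) = 0 < e j (a i)] is excluded by sign, [e i (a j) = 0 > e j (a i)] would make [e j
    \o act [:: i; j]] negative at the wall point of [i] and positive at that of [j]. *)
Lemma cartan_eq0_sym i j : e i (a j) = 0 -> e j (a i) = 0.
Proof.
have [->//|ij] := eqVneq i j; move=> aij.
apply/eqP; rewrite eq_le cartan_offdiag_le0 1?eq_sym//= leNgt; apply/negP => aji.
have [p p0 pp] := rd_wall rd i; have [q q0 qp] := rd_wall rd j.
have Cp := wall_closed p0 pp; have Cq := wall_closed q0 qp.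
have E x : e j (act [:: i; j] x) = - e j x - e i x * e j (a i).
  by rewrite /= !eval_refl aij ea; ring.
have [H|H] := act_side [:: i; j] j.
  have := act_side_pos H Cp; rewrite E p0 mul0r subr0 oppr_ge0 leNgt pp//.
  by rewrite eq_sym.
have := act_side_neg H Cq; rewrite E q0 oppr0 sub0r oppr_le0 leNgt.
by rewrite pmulr_rlt0 ?aji// qp.
Qed.

(* If the letter [j] after the prefix [v] crosses the wall of [i], then [e i \o act v]
   is a positive multiple of [e j], so [v^-1 s_i v s_j] fixes a point of the wall of
   [j] and keeps nearby points on the positive side: it is 1, and [s_i v = v s_j]. *)
Lemma act_exchange w i : (forall x, Ch x -> e i (act w x) < 0) ->
  exists2 w', (size w' < size w)%N & forall x, act w' x = refl i (act w x).
Proof.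
elim/last_ind: w => [|v j IH] neg.
  by have [d Cd] := rd_chamber rd; have := neg _ Cd; rewrite ltNge /= ltW.
have [pos|/IH[w' sw' w'E]] := act_side v i; last first.
  exists (rcons w' j); first by rewrite !size_rcons.
  by move=> x; rewrite !act_rcons.
exists v; first by rewrite size_rcons.
have [d Cd] := rd_chamber rd.
have [q q0 qp] := rd_wall rd j; have Cq := wall_closed q0 qp.
pose f x := e i (act v x).
have fP c x y : f (c *: x + y) = c * f x + f y by rewrite /f !linearP.
have fw x : e j x = 0 -> (forall k, k != j -> 0 < e k x) -> f x = 0.
  move=> x0 xp; have Cx := wall_closed x0 xp.
  apply/eqP; rewrite eq_le (act_side_pos pos Cx) andbT.
  by have := act_side_neg neg Cx; rewrite act_rcons refl_id.
(* A vector of the kernel of [e j], scaled down and added to [q], stays on the wall of [j] and off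
   the others, so [f] vanishes on the whole kernel. *)
have fk x : e j x = 0 -> f x = 0.
  move=> x0; have [eps eps0 /(_ _ eps0 (lexx _)) H] := small_pos (fun k => e k x) qp.
  have : f (eps *: x + q) = 0.
    apply: fw; first by rewrite linearP x0 q0/= mulr0 addr0.
    by move=> k kj; rewrite linearP/= addrC; exact: H.
  by rewrite fP (fw q)// addr0 => /eqP; rewrite mulf_eq0 gt_eqF//= => /eqP.
have fE x : f x = e j x * (f (a j) / 2).
  have -> : x = (e j x / 2) *: a j + (x - (e j x / 2) *: a j) by rewrite addrC subrK.
  rewrite fP [f (x - _)]fk ?linearP/=; last first.
    by rewrite linearB evalZ ea divfK ?subrr.
  rewrite linearB !evalZ ea; by field.
have fa0 : 0 < f (a j) / 2 by rewrite -(pmulr_rgt0 _ (Cd j)) -fE; exact: pos.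
pose u := rev v ++ i :: rcons v j.
have uE x : act u x = act (rev v) (refl i (act v (refl j x))).
  by rewrite /u act_cat /= act_rcons.
have uq : act u q = q by rewrite uE refl_id// refl_id ?act_revK//; exact: fw.
have ud : 0 < e j (act u d).
  rewrite -(pmulr_lgt0 _ fa0) -fE /f uE act_Krev// eval_refl_id//.
  by have := neg _ Cd; rewrite act_rcons oppr_gt0.
have [eps1 e10 H1] := small_pos (fun k => e k d) qp.
have [eps2 e20 H2] := small_pos (fun k => e k (act u d)) qp.
pose eps := Num.min eps1 eps2.
have eps0 : 0 < eps by rewrite lt_min e10.
have u1 : forall y, act u y = y.
  apply: (@rd_disjoint rd _ (eps *: d + q)) => k.
    rewrite linearP/=; have [->|kj] := eqVneq k j; first by rewrite q0 addr0 mulr_gt0.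
    by rewrite addrC; apply: H1 => //; rewrite ge_min lexx.
  rewrite linearP/= uq linearP/=.
  have [->|kj] := eqVneq k j; first by rewrite q0 addr0 mulr_gt0.
  by rewrite addrC; apply: H2 => //; rewrite ge_min lexx orbT.
move=> x; have := u1 x; rewrite uE => /(congr1 (act v)); rewrite act_Krev// => <-.
by rewrite act_rcons.
Qed.

Definition in_tits_cone (x : V) := exists w y, Chb y /\ x = act w y.

(** Induction on word length: if [e i] is negative on the image of the chamber under [w], exchange
    shortens the word after reflecting in [i]; otherwise [w] maps the chamber into itself and acts
    trivially. *)
Lemma tits_cone_ind (Q : V -> Prop) : (forall x, Chb x -> Q x) ->
  (forall i x, e i x <= 0 -> Q (refl i x) -> Q x) ->
  forall x, in_tits_cone x -> Q x.
Proof.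
move=> QC Qs x [w [y [Cy ->]]].
have [m] := ubnP (size w); elim: m w => // m IH w wm.
have [[i neg]|pos] := pselect (exists i, forall x, Ch x -> e i (act w x) < 0).
  apply: (Qs i); first exact: act_side_neg.
  have [w' sw' w'E] := act_exchange neg.
  by rewrite -w'E; apply: IH; apply: leq_trans sw' _.
have [d Cd] := rd_chamber rd.
rewrite (rd_disjoint rd Cd); first exact: QC.
by move=> i; have [H|neg] := act_side w i; [exact: H | case: pos; exists i].
Qed.

(* [y] is the coefficient vector of an antidominant nonnegative combination of
   the coroots, such as the canonical central element in affine type. *)
Lemma tits_cone_antidominant (y : 'I_n -> R) : (forall i, 0 <= y i) ->
  (forall j, \sum_i y i * e i (a j) <= 0) ->
  forall x, in_tits_cone x ->
    0 <= \sum_i y i * e i x /\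
    (\sum_i y i * e i x = 0 -> forall i, y i != 0 -> e i x = 0).
Proof.
move=> y0 ya; apply: tits_cone_ind => [x Cx|j x xj].
  split=> [|/eqP]; first by rewrite sumr_ge0// => i _; rewrite mulr_ge0.
  rewrite psumr_eq0 => [/allP H i yi|i _]; last by rewrite mulr_ge0.
  by have := H i; rewrite mem_index_enum mulf_eq0 (negPf yi) => /(_ isT)/eqP.
have E : \sum_i y i * e i (refl j x) = \sum_i y i * e i x - e j x * \sum_i y i * e i (a j).
  rewrite mulr_sumr -sumrB; apply: eq_bigr => i _; rewrite eval_refl; ring.
have t0 : 0 <= e j x * \sum_i y i * e i (a j) by rewrite mulr_le0.
move=> [r0 rE]; rewrite E in r0 rE; split; first by lra.
move=> x0; rewrite x0 in r0 rE.
have {t0} t0 : e j x * \sum_i y i * e i (a j) = 0 by lra.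
have {}rE : forall i, y i != 0 -> e i (refl j x) = 0.
  by apply: rE; rewrite t0 subr0.
have [xj0|xj0] := eqVneq (e j x) 0.
  by move=> i /rE; rewrite refl_id.
move/eqP: t0; rewrite mulf_eq0 (negPf xj0)/= => /eqP a0.
have yj : y j = 0.
  apply/eqP; apply: contraT => /rE; rewrite eval_refl_id// => /eqP.
  by rewrite oppr_eq0 (negPf xj0).
(* As [y j = 0], the summands are of one sign, hence all zero: [y i != 0] forces [e i (a j) = 0], so
   [e i] agrees at [x] and at its reflection. *)
have : - \sum_i y i * e i (a j) = 0 by rewrite a0 oppr0.
rewrite -sumrN => /eqP; rewrite psumr_eq0 => [/allP H i yi|i _]; last first.
  have [->|ij] := eqVneq i j; first by rewrite yj mul0r oppr0.
  by rewrite oppr_ge0 mulr_ge0_le0// cartan_offdiag_le0.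
have := H i; rewrite mem_index_enum oppr_eq0 mulf_eq0 (negPf yi) => /(_ isT)/eqP aij.
by have := rE i yi; rewrite eval_refl aij mulr0 subr0.
Qed.

End RootDatum.

(** * Finiteness in finite type *)

Lemma near_rowP (R : realType) (n : nat) (p : 'rV[R]_n) (P : set 'rV[R]_n) :
  nbhs p P <->
  exists2 d : R, 0 < d & forall u : 'rV[R]_n, (forall i, `|u 0 i - p 0 i| < d) -> P u.
Proof.
split=> [/nbhs_ballP[d /= d0 H]|[d d0 H]].
  exists d => // u up; apply: H; split => // i j.
  by rewrite ord1 /ball/= distrC.
apply/nbhs_ballP; exists d => //= u [_ up]; apply: H => i.
by have := up 0 i; rewrite /ball /= distrC.
Qed.

(** An affine form negative at [p] is negative in a ball around [p], whose radius is governed by the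
    sum of the [|c i|]. *)
Lemma cluster_affine_ge0 (R : realType) (n : nat) (F : set_system 'rV[R]_n)
    (p : 'rV[R]_n) (c : 'I_n -> R) (d : R) : cluster F p ->
  F [set u | 0 <= \sum_i u 0 i * c i + d] -> 0 <= \sum_i p 0 i * c i + d.
Proof.
move=> Fp Fc; rewrite leNgt; apply/negP => p0.
set v := \sum_i _ + d in p0.
have vE : v = \sum_i p 0 i * c i + d by [].
clearbody v.
have S0 : 0 <= \sum_i `|c i| by apply: sumr_ge0.
have : nbhs p [set u : 'rV[R]_n | \sum_i u 0 i * c i + d < 0].
  apply/near_rowP; exists (- v / (1 + \sum_i `|c i|)).
    by rewrite divr_gt0 ?oppr_gt0// ltr_pwDl.
  move=> u up; have : \sum_i u 0 i * c i + d - v <= (- v / (1 + \sum_i `|c i|)) * \sum_i `|c i|.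
    rewrite {1}vE opprD addrACA subrr addr0 -sumrB mulr_sumr; apply: ler_sum => i _.
    rewrite -mulrBl; apply: le_trans (ler_norm _) _; rewrite normrM ler_wpM2r//.
    exact: ltW (up i).
  have : - v / (1 + \sum_i `|c i|) * \sum_i `|c i| < - v.
    by rewrite mulrAC ltr_pdivrMr ?ltr_pwDl// ltr_pM2l ?oppr_gt0// ltrDr.
  by move=> h1 h2 /=; lra.
by move=> /(Fp _ _ Fc)[u [/= u0]]; rewrite ltNge u0.
Qed.

(** A free family of maximal length among those drawn from the possibly infinite set [S]. *)
Lemma exists_free_span (K : fieldType) (V : vectType K) (S : set V) :
  exists X : seq V, [/\ forall x, x \in X -> S x, free X &
                        forall x, S x -> x \in <<X>>%VS].
Proof.
pose P m := `[< exists X : seq V, [/\ size X = m, forall x, x \in X -> S x & free X] >].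
have P0 : exists m, P m by exists 0%N; apply/asboolP; exists [::]; rewrite nil_free.
have Pmax m : P m -> (m <= \dim {:V})%N.
  move=> /asboolP[X [<- _ /eqP <-]]; exact: dimvS (subvf _).
case: (ex_maxnP P0 Pmax) => m /asboolP[X [Xm XS Xfree]] mmax.
exists X; split => // x Sx; apply: contraT => xX.
have := mmax m.+1; rewrite ltnn => /(_ _); apply; apply/asboolP; exists (x :: X).
rewrite free_cons xX Xfree /= Xm; split=> // y; rewrite inE => /orP[/eqP->//|].
exact: XS.
Qed.

(** * The reflection action on coefficient vectors *)

Section CoefficientAction.
Variables (R : realType) (n : nat) (A : 'M[R]_n) (J : {set 'I_n}).

(* Right multiplication by [reflmx j] is the reflection [s_j] on row vectors of
   coefficients with respect to the coroots. *)
Definition reflmx j : 'M[R]_n := 1%:M - col j A *m delta_mx 0 j.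
Definition actmx (w : seq 'I_n) : 'M[R]_n := foldr (fun j M => reflmx j *m M) 1%:M w.

Lemma mul_reflmx (y : 'rV[R]_n) j k :
  (y *m reflmx j) 0 k = y 0 k - (k == j)%:R * \sum_i y 0 i * A i j.
Proof.
rewrite mulmxBr mulmx1 mulmxA mxE; congr (_ + _); rewrite !mxE big_ord1 !mxE eqxx /=.
by rewrite mulrC; congr (- (_ * _)); apply: eq_bigr => i _; rewrite mxE.
Qed.

Lemma actmx_cat w1 w2 : actmx (w1 ++ w2) = actmx w1 *m actmx w2.
Proof. by elim: w1 => [|i w IH] /=; rewrite ?mul1mx// IH mulmxA. Qed.

Hypothesis A2 : forall i, A i i = 2.

Lemma reflmxK j : reflmx j *m reflmx j = 1%:M.
Proof.
apply/row_matrixP => i; rewrite !rowE mulmxA mulmx1; set y := delta_mx 0 i.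
apply/rowP => k; rewrite mul_reflmx mul_reflmx.
have -> : \sum_i0 (y *m reflmx j) 0 i0 * A i0 j = - \sum_i0 y 0 i0 * A i0 j.
  under eq_bigr do rewrite mul_reflmx mulrBl.
  rewrite sumrB (bigD1 j (F := fun i => _ * _ * A i j))//= eqxx mul1r A2.
  rewrite [X in _ - (_ + X)]big1 ?addr0; last by move=> l /negPf->; rewrite !mul0r.
  ring.
ring.
Qed.

Definition heightv (y : 'rV[R]_n) : R := \sum_i y 0 i.

(** A cone invariant under the reflections in [J]; its triviality in finite type is the core of the
    finiteness proof. *)
Definition stably_nonneg (y : 'rV[R]_n) : Prop :=
  (forall i, i \notin J -> y 0 i = 0) /\
  forall w, all (fun j => j \in J) w -> forall i, 0 <= (y *m actmx w) 0 i.

Lemma stably_nonneg_ge0 y : stably_nonneg y -> forall i, 0 <= y 0 i.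
Proof. by move=> [_ /(_ [::] isT)] /=; rewrite mulmx1. Qed.

Lemma stably_nonneg_refl y j : j \in J -> stably_nonneg y -> stably_nonneg (y *m reflmx j).
Proof.
move=> jJ [ys yp]; split=> [i iJ|w wJ].
  rewrite mul_reflmx ys//; case: eqP => [ij|_]; last by rewrite mul0r subr0.
  by move: iJ; rewrite ij jJ.
by move=> i; have := yp (j :: w); rewrite /= jJ /= => /(_ wJ); rewrite mulmxA.
Qed.

Lemma stably_nonneg_act y w : all (fun j => j \in J) w -> stably_nonneg y ->
  stably_nonneg (y *m actmx w).
Proof.
elim: w y => [|j w IH] y /=; first by rewrite mulmx1.
by move=> /andP[jJ wJ] yP; rewrite mulmxA; apply: IH => //; exact: stably_nonneg_refl.
Qed.

Lemma stably_nonneg_sum (I : Type) (r : seq I) (f : I -> 'rV[R]_n) :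
  (forall i, stably_nonneg (f i)) -> stably_nonneg (\sum_(i <- r) f i).
Proof.
move=> fP; split=> [i iJ|w wJ i].
  by rewrite summxE big1// => k _; case: (fP k) => ->.
by rewrite mulmx_suml summxE sumr_ge0// => k _; case: (fP k) => _ /(_ w wJ).
Qed.

Hypothesis Jfin : finite_type A J.

(** Reflecting in [j] lowers the height by entry [j] of [y A]. The average of these entries with
    weights [u] is at least [m / s] times the height, so some entry reaches that fraction. *)
Lemma greedy_reflection j0 : j0 \in J -> exists2 k : R, 0 <= k < 1 &
  forall y : 'rV[R]_n, (forall i, 0 <= y 0 i) -> (forall i, i \notin J -> y 0 i = 0) ->
  exists2 j, j \in J & heightv (y *m reflmx j) <= k * heightv y.
Proof.
case: Jfin => u [u0 Au] j0J.
have [m m0 mA] : exists2 m : R, 0 < m & forall i, i \in J -> m <= \sum_(j in J) A i j * u j.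
  case: (Order.TotalTheory.arg_minP (fun i => \sum_(j in J) A i j * u j) j0J) => i iJ imin.
  by exists (\sum_(j in J) A i j * u j) => //; exact: Au.
pose s := \sum_(j in J) u j.
have s0 : 0 < s.
  rewrite /s (bigD1 j0)//=; apply: ltr_pwDl; first exact: u0.
  by apply: sumr_ge0 => j /andP[/u0/ltW].
pose q := Num.min (m / s) 1.
have q0 : 0 < q by rewrite lt_min divr_gt0//= ltr01.
have q1 : q <= 1 by rewrite ge_min lexx orbT.
exists (1 - q); first by apply/andP; split; lra.
move=> y y0 yJ; have ht0 : 0 <= heightv y by apply: sumr_ge0.
have htS j : heightv (y *m reflmx j) = heightv y - \sum_i y 0 i * A i j.
  rewrite /heightv; under eq_bigr do rewrite mul_reflmx.
  rewrite sumrB (bigD1 j (F := fun i => _ * _))//= eqxx mul1r.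
  by rewrite [X in _ - (_ + X)]big1 ?addr0// => l /negPf->; rewrite mul0r.
apply: contrapT => H.
have {}H j : j \in J -> \sum_i y 0 i * A i j < q * heightv y.
  move=> jJ; rewrite ltNge; apply/negP => h; apply: H; exists j => //.
  by rewrite htS; lra.
have : \sum_(j in J) u j * (\sum_i y 0 i * A i j) < s * (q * heightv y).
  rewrite /s mulr_suml; apply: ltr_sum; first by apply/hasP; exists j0; rewrite ?mem_index_enum.
  by move=> j jJ; rewrite ltr_pM2l ?u0// H.
have : m * heightv y <= \sum_(j in J) u j * (\sum_i y 0 i * A i j).
  under eq_bigr do rewrite mulr_sumr.
  rewrite exchange_big /= /heightv mulr_sumr; apply: ler_sum => i _.
  under eq_bigr => j _ do rewrite mulrCA [u j * _]mulrC.
  rewrite -mulr_sumr mulrC.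
  have [iJ|iJ] := boolP (i \in J); last by rewrite yJ// !mul0r.
  by rewrite ler_wpM2l ?mA.
have : s * q <= m by rewrite mulrC -ler_pdivlMr// ge_min lexx.
nra.
Qed.

Lemma height_decay (y : 'rV[R]_n) j0 (eps : R) : j0 \in J -> stably_nonneg y -> 0 < eps ->
  exists2 w, all (fun j => j \in J) w & heightv (y *m actmx w) < eps.
Proof.
move=> j0J yP eps0; have [k /andP[k0 k1] H] := greedy_reflection j0J.
have step m : exists2 w, all (fun j => j \in J) w & heightv (y *m actmx w) <= k ^+ m * heightv y.
  elim: m => [|m [w wJ IH]]; first by exists [::] => //=; rewrite mulmx1 expr0 mul1r.
  have wP := stably_nonneg_act wJ yP.
  have [j jJ Hj] := H _ (stably_nonneg_ge0 wP) wP.1.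
  exists (rcons w j); first by rewrite all_rcons jJ.
  rewrite -cats1 actmx_cat /= mulmx1 mulmxA; apply: le_trans Hj _.
  by rewrite exprS -mulrA ler_wpM2l.
have ht0 : 0 <= heightv y by apply: sumr_ge0 => i _; exact: stably_nonneg_ge0.
have : k ^+ m @[m --> \oo] --> (0 : R) by apply: cvg_expr; rewrite ger0_norm.
have e1 : 0 < eps / (1 + heightv y) by rewrite divr_gt0// ltr_pwDl.
move=> /cvgrPdist_lt/(_ _ e1)[N _ /(_ N (leqnn N))] /=.
rewrite sub0r normrN ger0_norm ?exprn_ge0// => kN.
have [w wJ wN] := step N; exists w => //; apply: le_lt_trans wN _.
rewrite ltr_pdivlMr ?ltr_pwDl// in kN; apply: le_lt_trans kN.
by rewrite ler_wpM2l ?exprn_ge0// lerDr.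
Qed.

(* The greedy words shrink the whole span of the invariant cone to zero, yet act
   on it with determinant 1 or -1. *)
Lemma stably_nonneg_eq0 y : stably_nonneg y -> y = 0.
Proof.
move=> yP; apply: contrapT => yn0.
have [j0 j0J] : exists j, j \in J.
  apply: contrapT => J0; apply: yn0; apply/rowP => i; rewrite mxE yP.1//.
  by apply/negP => iJ; apply: J0; exists i.
have [X [XP Xfree Xspan]] := exists_free_span (stably_nonneg : set 'rV[R]_n).
pose d := size X; pose T := in_tuple X.
have d0 : (0 < d)%N.
  rewrite lt0n size_eq0; apply/eqP => X0; apply: yn0.
  by have := Xspan _ yP; rewrite X0 span_nil memv0 => /eqP.
have TP (i : 'I_d) : stably_nonneg T`_i by apply/XP/mem_nth.
have Tfree : free T by [].
(* Matrix of right multiplication by [M] in the basis [T]; products are respected when the first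
   factor preserves the span. *)
pose G (M : 'M[R]_n) : 'M[R]_d := \matrix_(i, j) coord T j (T`_i *m M).
have GM M N : (forall i : 'I_d, T`_i *m M \in <<T>>%VS) -> G (M *m N) = G M *m G N.
  move=> MT; apply/matrixP => i j; rewrite !mxE mulmxA {1}(coord_span (MT i)).
  rewrite mulmx_suml linear_sum; apply: eq_bigr => k _.
  by rewrite !mxE -scalemxAl linearZ.
have G1 : G 1%:M = 1%:M.
  by apply/matrixP => i j; rewrite !mxE mulmx1 coord_free// eq_sym.
have GS j : j \in J -> \det (G (reflmx j)) ^+ 2 = 1.
  move=> jJ; rewrite expr2 -det_mulmx -GM ?reflmxK ?G1 ?det1// => i.
  exact/Xspan/stably_nonneg_refl.
have Gw w : all (fun j => j \in J) w -> \det (G (actmx w)) ^+ 2 = 1.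
  elim: w => [_|j w IH] /=; first by rewrite G1 det1 expr1n.
  move=> /andP[jJ wJ]; rewrite GM; last by move=> i; exact/Xspan/stably_nonneg_refl.
  by rewrite det_mulmx exprMn GS// IH// mulr1.
pose c : R := \sum_(j < d) \sum_k `|coord T j (delta_mx 0 k)|.
have c0 : 0 <= c by apply: sumr_ge0 => j _; apply: sumr_ge0.
have coordle (j : 'I_d) (v : 'rV[R]_n) : (forall i, 0 <= v 0 i) -> `|coord T j v| <= c * heightv v.
  move=> v0; rewrite {1}(row_sum_delta v) linear_sum mulrC mulr_suml.
  apply: le_trans (ler_norm_sum _ _ _) _; apply: ler_sum => k _.
  rewrite linearZ normrM ger0_norm// ler_wpM2l//.
  rewrite /c (bigD1 j)//= (bigD1 k)//= -addrA lerDl addr_ge0// ?sumr_ge0// => i _.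
  by apply: sumr_ge0.
pose z := \sum_(i < d) T`_i.
have zP : stably_nonneg z by apply: stably_nonneg_sum.
(* The factorial of [d] counts the terms of the Leibniz expansion: entries of size at most [c * eps]
   give a determinant below 1 in absolute value. *)
pose eps := ((1 + c) * (d`!)%:R)^-1.
have f0 : 0 < (d`!)%:R :> R by rewrite ltr0n fact_gt0.
have eps0 : 0 < eps by rewrite invr_gt0 mulr_gt0// ltr_pwDl.
have [w wJ wz] := height_decay j0J zP eps0.
have Gle i j : `|G (actmx w) i j| <= c * eps.
  rewrite mxE; apply: le_trans (coordle _ _ _) _.
    by have := stably_nonneg_act wJ (TP i); exact: stably_nonneg_ge0.
  rewrite ler_wpM2l//; apply: le_trans (ltW wz).
  rewrite /z /heightv mulmx_suml; apply: ler_sum => k _.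
  rewrite summxE (bigD1 i)//= lerDl sumr_ge0// => l _.
  by have := stably_nonneg_act wJ (TP l); move/stably_nonneg_ge0.
have ce0 : 0 <= c * eps by rewrite mulr_ge0// ltW.
have ce : c * eps * (d`!)%:R < 1.
  rewrite /eps invfM mulrA mulfVK ?gt_eqF// ltr_pdivrMr ?ltr_pwDl// mul1r.
  by rewrite ltrDr ltr01.
have ce1 : c * eps <= 1.
  apply: ltW; apply: le_lt_trans ce; rewrite ler_peMr//.
  by rewrite ler1n fact_gt0.
have : `|\det (G (actmx w))| < 1.
  apply: le_lt_trans ce; apply: le_trans (ler_norm_sum _ _ _) _.
  apply: (@le_trans _ _ (\sum_(s : 'S_d) c * eps)); last first.
    by rewrite sumr_const card_Sn mulr_natr.
  apply: ler_sum => s _; rewrite normrM normrX normrN1 expr1n mul1r normr_prod.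
  rewrite (bigD1 (Ordinal d0))//= -[leRHS]mulr1; apply: ler_pM => //.
    by apply: prodr_ge0.
  by apply: Num.Theory.prodr_ile1 => i _; rewrite normr_ge0 (le_trans (Gle _ _)).
by rewrite -(@expr_lt1 _ 2)// real_normK ?num_real// Gw// ltxx.
Qed.

(** Otherwise, for each [m], some vector of height 1 stays nonnegative under all words of length at
    most [m]; a cluster point in the unit box is stably nonnegative and nonzero, contradicting
    [stably_nonneg_eq0]. *)
Lemma uniform_negative_word : exists m, forall y : 'rV[R]_n, y != 0 ->
  (forall i, 0 <= y 0 i) -> (forall i, i \notin J -> y 0 i = 0) ->
  exists w, [/\ (size w <= m)%N, all (fun j => j \in J) w &
                exists i, (y *m actmx w) 0 i < 0].
Proof.
apply: contrapT => /forallNP H.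
have {}H m : exists y : 'rV[R]_n, [/\ heightv y = 1, forall i, 0 <= y 0 i,
    forall i, i \notin J -> y 0 i = 0 &
    forall w, (size w <= m)%N -> all (fun j => j \in J) w ->
      forall i, 0 <= (y *m actmx w) 0 i].
  apply: contrapT => Hm; apply: (H m) => y yn0 y0 yJ; apply: contrapT => Hy.
  have ht0 : 0 < heightv y.
    rewrite lt_neqAle sumr_ge0 ?andbT//; apply: contra yn0.
    rewrite eq_sym psumr_eq0// => /allP y00; apply/eqP/rowP => i; rewrite mxE.
    by apply/eqP/y00; rewrite mem_index_enum.
  apply: Hm; exists ((heightv y)^-1 *: y); split.
  - rewrite /heightv; under eq_bigr do rewrite mxE.
    by rewrite -mulr_sumr mulVf ?gt_eqF.
  - by move=> i; rewrite mxE mulr_ge0// invr_ge0 ltW.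
  - by move=> i /yJ yi; rewrite mxE yi mulr0.
  - move=> w wm wJ i; rewrite -scalemxAl mxE mulr_ge0 ?invr_ge0 ?(ltW ht0)//.
    by rewrite leNgt; apply/negP => neg; apply: Hy; exists w; split => //; exists i.
have [y yP] := choice H.
have box := @rV_compact R n (fun=> `[0 : R, 1]%classic) (fun=> @segment_compact R 0 1).
have Fbox : (y @ \oo) [set v : 'rV[R]_n | forall i, v ord0 i \in `[0, 1]].
  exists 0%N => // m _ /= i; rewrite in_itv /=.
  have [<- y0 _ _] := yP m; rewrite y0 /= /heightv (bigD1 i)//= lerDl.
  by apply: sumr_ge0.
have [p [_ pc]] := box _ (fmap_proper_filter y eventually_filter) Fbox.
(* All that is required of [p] is expressed by affine inequalities; vanishing outside [J] comes as
   two of them. *)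
have lim (N : nat) (c : 'I_n -> R) (d : R) :
    (forall m, (N <= m)%N -> 0 <= \sum_i y m 0 i * c i + d) ->
    0 <= \sum_i p 0 i * c i + d.
  move=> Hc; apply: (cluster_affine_ge0 pc); exists N => // m /= Nm; exact: Hc.
have sum1 (f : 'I_n -> R) i (b : R) : \sum_k f k * ((k == i)%:R * b) = f i * b.
  by rewrite (bigD1 i)//= eqxx mul1r big1 ?addr0// => k /negPf->; rewrite mul0r mulr0.
have pP : stably_nonneg p.
  split=> [i iJ|w wJ i].
    have p0 (b : R) : 0 <= p 0 i * b.
      rewrite -sum1 -[leRHS]addr0; apply: (lim 0%N) => m _.
      by rewrite sum1 addr0; have [_ _ ->//] := yP m; rewrite mul0r.
    by have := p0 1; have := p0 (-1); lra.
  rewrite mxE -[leRHS]addr0; apply: (lim (size w)) => m mw; rewrite addr0.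
  by have [_ _ _ /(_ w mw wJ i)] := yP m; rewrite mxE.
have := stably_nonneg_eq0 pP => p0.
have : 0 <= \sum_i p 0 i * 1 + (-1).
  apply: (lim 0%N) => m _; under eq_bigr do rewrite mulr1.
  by have [E _ _ _] := yP m; rewrite -/(heightv (y m)) E subrr.
by rewrite p0 big1 => [|i _]; [lra | rewrite mxE mul0r].
Qed.

End CoefficientAction.

(** * Roots and the finiteness of the action of words in [J] *)

Section FiniteTypeWords.
Variables (R : realType) (V : lmodType R) (n : nat).
Variables (e : 'I_n -> {scalar V}) (a : 'I_n -> V).
Local Notation act := (word_act e a).
Local Notation refl := (simple_refl e a).
Let A : 'M[R]_n := \matrix_(i, j) e i (a j).
Local Notation reflmx := (reflmx A).
Local Notation actmx := (actmx A).

Variable J : {set 'I_n}.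
Local Notation inJ w := (all (fun j => j \in J) w).

Definition pairing (y : 'rV[R]_n) (x : V) : R := \sum_i y 0 i * e i x.

Lemma pairing_delta j x : pairing (delta_mx 0 j) x = e j x.
Proof.
rewrite /pairing (bigD1 j)//= mxE !eqxx mul1r big1 ?addr0// => i ij.
by rewrite mxE (negPf ij) andbF mul0r.
Qed.

Lemma pairingZl c y x : pairing (c *: y) x = c * pairing y x.
Proof. by rewrite /pairing mulr_sumr; apply: eq_bigr => i _; rewrite mxE mulrA. Qed.

Lemma pairing_linear y : linear_for *%R (pairing y).
Proof.
move=> c x z; rewrite /pairing mulr_sumr -big_split; apply: eq_bigr => i _ /=.
by rewrite linearP/= mulrDr mulrCA.
Qed.
HB.instance Definition _ y :=
  GRing.isLinear.Build R V R *%R (pairing y) (pairing_linear y).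

Lemma pairing_reflmx y j x : pairing (y *m reflmx j) x = pairing y (refl j x).
Proof.
rewrite /pairing; under eq_bigr do rewrite mul_reflmx mulrBl.
under [RHS]eq_bigr do rewrite eval_refl mulrBr.
rewrite !sumrB; congr (_ - _).
rewrite [LHS](bigD1 j)//= eqxx mul1r [X in _ + X]big1 ?addr0 => [|l /negPf->].
  by rewrite mulr_suml; apply: eq_bigr => i _; rewrite mxE; ring.
by rewrite !mul0r.
Qed.

Lemma pairing_actmx y w x : pairing (y *m actmx w) x = pairing y (act w x).
Proof.
elim: w y => [|j w IH] y /=; first by rewrite mulmx1.
by rewrite mulmxA IH pairing_reflmx.
Qed.

(** The functionals [e j \o act w], recorded by coefficients so that the compactness argument
    applies to them. *)
Definition is_root (y : 'rV[R]_n) : Prop :=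
  exists j w, [/\ j \in J, inJ w & y = delta_mx 0 j *m actmx w].

Lemma is_root_act y w : is_root y -> inJ w -> is_root (y *m actmx w).
Proof.
move=> [j [v [jJ vJ ->]]] wJ; exists j, (v ++ w); split => //.
  by rewrite all_cat vJ.
by rewrite actmx_cat mulmxA.
Qed.

Lemma is_root_supp y i : is_root y -> i \notin J -> y 0 i = 0.
Proof.
move=> [j [w [jJ wJ ->]]] iJ {y}.
have : (delta_mx 0 j : 'rV[R]_n) 0 i = 0.
  by rewrite mxE andTb; case: eqP => // ij; move: iJ; rewrite ij jJ.
elim: w (delta_mx 0 j) wJ => [|k w IH] y /=; first by rewrite mulmx1.
move=> /andP[kJ wJ] y0; rewrite mulmxA; apply: IH => //.
rewrite mul_reflmx y0; case: eqP => [ik|_]; last by rewrite mul0r subr0.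
by move: iJ; rewrite ik kJ.
Qed.

Hypothesis rd : root_datum e a.
Hypothesis Jfin : finite_type A J.
Let ea := rd_two rd.

Let A2 i : A i i = 2. Proof. by rewrite mxE ea. Qed.
Let Aoff i j : i != j -> A i j <= 0.
Proof. by move=> ij; rewrite mxE; exact: (cartan_offdiag_le0 rd). Qed.

Lemma is_rootN y : is_root y -> is_root (- y).
Proof.
move=> [j [w [jJ wJ ->]]]; exists j, (j :: w); split => //=; first by rewrite jJ.
rewrite mulmxA -mulNmx; congr (_ *m _); apply/rowP => i; rewrite mul_reflmx.
have -> : \sum_k (delta_mx 0 j : 'rV[R]_n) 0 k * A k j = 2.
  rewrite (bigD1 j)//= mxE !eqxx mul1r A2 big1 ?addr0// => k kj.
  by rewrite mxE (negPf kj) andbF mul0r.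
by rewrite !mxE eqxx /=; case: eqP => _ /=; ring.
Qed.

(** From a chamber point [d], subtract the combination of the [a j] that cancels its values on [J].
    The coefficients are nonnegative by monotonicity, so the values outside [J] do not decrease. *)
Lemma facet_point : exists m, (forall j, j \in J -> e j m = 0) /\
                             (forall i, i \notin J -> 0 < e i m).
Proof.
have [d Cd] := rd_chamber rd.
have [c cE] := finite_type_solve Aoff Jfin (fun i => e i d).
have c0 j : j \in J -> 0 <= c j.
  by apply: (finite_type_monotone Aoff Jfin) => i iJ; rewrite cE// ltW.
have E i : e i (d - \sum_(j in J) c j *: a j) = e i d - \sum_(j in J) A i j * c j.
  rewrite linearB linear_sum; congr (_ - _); apply: eq_bigr => j _.
  by rewrite evalZ mxE mulrC.
exists (d - \sum_(j in J) c j *: a j); split=> [j jJ|i iJ].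
  by rewrite E cE// subrr.
rewrite E; apply: lt_le_trans (Cd i) _; rewrite lerDl oppr_ge0.
apply: sumr_le0 => j jJ; rewrite mulr_le0_ge0 ?c0// Aoff//.
by apply: contraNneq iJ => ->.
Qed.

Lemma act_fix w m : inJ w -> (forall j, j \in J -> e j m = 0) -> act w m = m.
Proof.
move=> wJ m0; elim: w wJ => [//|j w IH] /= /andP[jJ wJ].
by rewrite IH// refl_id// m0.
Qed.

Definition in_Jchamber (x : V) := forall j, j \in J -> 0 < e j x.

(* Adding a small multiple of [x] to a point of the open facet of [J], which the
   words in [J] fix, replaces the chamber of [J] by the whole chamber. *)
Lemma act_Jchamber_id w x : inJ w -> in_Jchamber x -> in_Jchamber (act w x) ->
  forall y, act w y = y.
Proof.
move=> wJ Cx Cwx; have [m [m0 mp]] := facet_point.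
have [e1 e10 H1] := small_pos (fun i => e i x) mp.
have [e2 e20 H2] := small_pos (fun i => e i (act w x)) mp.
pose eps := Num.min e1 e2.
have eps0 : 0 < eps by rewrite lt_min e10.
apply: (@rd_disjoint _ _ _ _ _ rd _ (eps *: x + m)) => i; rewrite !linearP/=.
  have [iJ|iJ] := boolP (i \in J); first by rewrite m0// addr0 mulr_gt0// Cx.
  by rewrite addrC; apply: H1 => //; rewrite ge_min lexx.
rewrite (act_fix wJ m0); have [iJ|iJ] := boolP (i \in J).
  by rewrite m0// addr0 mulr_gt0// Cwx.
by rewrite addrC; apply: H2 => //; rewrite ge_min lexx orbT.
Qed.

(** A zero would yield a conjugate of a reflection fixing a point of the chamber of [J], hence
    acting trivially. *)
Lemma pairing_root_neq0 y x : is_root y -> in_Jchamber x -> pairing y x <> 0.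
Proof.
move=> [j [w [jJ wJ ->]]] Cx; rewrite pairing_actmx pairing_delta => wx0.
have /(conjugate_neq1 rd) // : forall y, act (rev w ++ j :: w) y = y.
apply: (@act_Jchamber_id _ x) => //; first by rewrite all_cat /= all_rev wJ jJ.
by rewrite act_cat /= refl_id// act_revK.
Qed.

(** Coefficient [i] is the value of the root at a fundamental vector, dual to [e i] on [J], in the
    closure of the chamber of [J]. *)
Lemma root_coef_ge0 y : is_root y -> (forall x, in_Jchamber x -> 0 < pairing y x) ->
  forall i, 0 <= y 0 i.
Proof.
move=> yr yp i; have [iJ|iJ] := boolP (i \in J); last by rewrite (is_root_supp yr).
have [c cE] := finite_type_solve Aoff Jfin (fun k => (k == i)%:R).
have [d Cd] := rd_chamber rd.
pose x := \sum_(j in J) c j *: a j.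
have xE k : k \in J -> e k x = (k == i)%:R.
  move=> kJ; rewrite -cE// linear_sum; apply: eq_bigr => j _.
  by rewrite evalZ mxE mulrC.
have <- : pairing y x = y 0 i.
  rewrite /pairing (bigD1 i)//= xE// eqxx mulr1 big1 ?addr0// => k ki.
  have [kJ|kJ] := boolP (k \in J); first by rewrite xE// (negPf ki) mulr0.
  by rewrite (is_root_supp yr)// mul0r.
apply: (@ge0_of_pos_perturb _ _ (pairing y d)) => eps eps0.
rewrite addrC -pairing_linear ltW// yp// => k kJ.
by rewrite linearP/= xE// ltr_pwDl ?mulr_gt0// ler0n.
Qed.

Lemma root_sign y : is_root y -> (forall i, 0 <= y 0 i) \/ (forall i, 0 <= (- y) 0 i).
Proof.
move=> yr; have [d Cd] := rd_chamber rd.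
have CdJ : in_Jchamber d by move=> j _.
have sgn z x : is_root z -> 0 < pairing z d -> in_Jchamber x -> 0 < pairing z x.
  move=> zr zd Cx; apply: (@convex_sign _ _ in_Jchamber (pairing z) _ _ _ d x) => //.
  - by move=> u v Cu Cv j jJ; rewrite linearD addr_gt0 ?Cu ?Cv.
  - by move=> t u t0 Cu j jJ; rewrite evalZ mulr_gt0 ?Cu.
  - by move=> u Cu; exact: pairing_root_neq0.
have [dp|dn] := ltP 0 (pairing y d); [left|right].
  by apply: root_coef_ge0 => // x; exact: sgn.
have yNr := is_rootN yr.
apply: root_coef_ge0 => // x; apply: sgn => //.
rewrite -scaleN1r pairingZl mulN1r oppr_gt0 lt_neqAle dn andbT.
by apply/eqP/pairing_root_neq0.
Qed.

(* Along a word turning the positive root [y] negative, the root passes through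
   a positive multiple of a simple one, the only positive roots that a simple
   reflection makes negative. *)
Lemma root_to_simple y w : is_root y -> (forall i, 0 <= y 0 i) -> inJ w ->
  (exists i, (y *m actmx w) 0 i < 0) ->
  exists w1 j (c : R), [/\ (size w1 <= size w)%N, inJ w1, j \in J, 0 < c &
                    y = c *: (delta_mx 0 j *m actmx w1)].
Proof.
elim: w y => [|j w IH] y yr y0 /= => [_ [i]|/andP[jJ wJ]].
  by rewrite mulmx1 ltNge y0.
have [yn0|] := pselect (exists i, 0 < y 0 i); last first.
  move=> yn0 [i]; rewrite (_ : y = 0) ?mul0mx ?mxE ?ltxx//.
  apply/rowP => k; rewrite mxE; apply/eqP; rewrite eq_le y0 andbT leNgt.
  by apply/negP => yk; apply: yn0; exists k.
rewrite mulmxA => neg.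
have jr : is_root (y *m reflmx j).
  by have := is_root_act (w := [:: j]) yr; rewrite /= mulmx1 jJ; apply.
have [yj|yj] := root_sign jr.
  have [w1 [k [c [sw w1J kJ c0 yE]]]] := IH _ jr yj wJ neg.
  exists (rcons w1 j), k, c; split => //.
  - by rewrite size_rcons.
  - by rewrite all_rcons jJ.
  - rewrite -cats1 actmx_cat /= mulmx1 mulmxA scalemxAl -yE -mulmxA.
    by rewrite reflmxK// mulmx1.
(* The reflection changes only coordinate [j], so a nonnegative [y] with nonpositive image is
   supported at [j]. *)
have y00 k : k != j -> y 0 k = 0.
  move=> kj; have := yj k; rewrite mxE mul_reflmx (negPf kj) mul0r subr0 oppr_ge0 => yk.
  by apply/eqP; rewrite eq_le yk y0.
exists [::], j, (y 0 j); split => //.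
  by have [i] := yn0; have [->//|/y00->] := eqVneq i j; rewrite ltxx.
rewrite mulmx1; apply/rowP => k; rewrite !mxE eqxx /=.
by have [->|/y00->] := eqVneq k j; rewrite ?mulr1 ?mulr0.
Qed.

Lemma finite_type_words : exists ws : seq (seq 'I_n), forall w, inJ w ->
  exists2 w', w' \in ws & forall x, act w x = act w' x.
Proof.
have [m mP] := uniform_negative_word A2 Jfin.
have [d Cd] := rd_chamber rd.
have CdJ : in_Jchamber d by move=> j _.
(* The signs at [act w d] of the finitely many roots given by words of length at most [m]. *)
pose pat (w : seq 'I_n) : {ffun 'I_n * m.-bseq 'I_n -> bool} :=
  [ffun v : 'I_n * m.-bseq 'I_n => 0 < pairing (delta_mx 0 v.1 *m actmx v.2) (act w d)].
have key w w' y : pat w = pat w' -> is_root y -> (forall i, 0 <= y 0 i) -> y != 0 ->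
    (0 < pairing y (act w d)) = (0 < pairing y (act w' d)).
  move=> pE yr y0 yn0.
  have [v [vm vJ neg]] := mP y yn0 y0 (fun i => @is_root_supp y i yr).
  have [v1 [j [c [sv v1J jJ c0 yE]]]] := root_to_simple yr y0 vJ neg.
  have v1m : (size v1 <= m)%N by apply: leq_trans vm.
  have := congr1 (fun f : {ffun _ -> bool} => f (j, Bseq v1m)) pE.
  by rewrite !ffunE /= yE !pairingZl !pmulr_rgt0.
(* Equal patterns give equal signs on every positive root, so [rev w ++ w'] keeps [d] in the chamber
   of [J] and acts trivially. *)
have inj w w' : inJ w -> inJ w' -> pat w = pat w' -> forall x, act w x = act w' x.
  move=> wJ w'J pE x.
  suff H : forall y, act (rev w ++ w') y = y.
    by have := H x; rewrite act_cat => /(congr1 (act w)); rewrite act_Krev// => ->.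
  apply: (act_Jchamber_id (x := d)) => //; first by rewrite all_cat all_rev wJ.
  move=> j jJ; pose y := (delta_mx 0 j : 'rV[R]_n) *m actmx (rev w).
  have yr : is_root y by exists j, (rev w); rewrite all_rev.
  have yE z : pairing y z = e j (act (rev w) z) by rewrite pairing_actmx pairing_delta.
  have yw : 0 < pairing y (act w d) by rewrite yE act_revK.
  have yn0 : y != 0.
    by apply: contraTneq yw => ->; rewrite /pairing big1 ?ltxx// => i _; rewrite mxE mul0r.
  have [y0|yN0] := root_sign yr.
    by rewrite act_cat -yE -(key w w').
  have yNn0 : - y != 0 by rewrite oppr_eq0.
  have := key _ _ _ pE (is_rootN yr) yN0 yNn0.
  rewrite -scaleN1r !pairingZl !mulN1r !oppr_gt0 ltNge (ltW yw) /= => /esym/negbT.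
  (* The negated root yields only a weak inequality; equality is excluded because no word moves [d]
     onto a wall. *)
  rewrite -leNgt yE -act_cat le_eqVlt => /orP[/eqP/esym|//].
  by move/(act_off_wall rd) => [].
(* One word per pattern; a pattern that no word in [J] realises contributes the default [[::]]. *)
exists [seq xget [::] [set w | inJ w /\ pat w = t] | t : {ffun 'I_n * m.-bseq 'I_n -> bool}].
move=> w wJ; pose w' := xget [::] [set v | inJ v /\ pat v = pat w].
have [w'J w'E] : inJ w' /\ pat w' = pat w.
  by apply: (@xgetI _ _ [set v | inJ v /\ pat v = pat w] w).
exists w'; first by apply/mapP; exists (pat w) => //; rewrite mem_enum.
exact: inj.
Qed.

End FiniteTypeWords.

(** * Relative interiors of convex cones *)

Section RelativeInterior.
Variables (R : realType) (V : vectType R) (K : set V).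
Hypotheses (Kcone : convex_cone K) (K0 : K 0).

Lemma coneZ (c : R) x : 0 <= c -> K x -> K (c *: x).
Proof.
rewrite le_eqVlt => /orP[/eqP<- _|c0 Kx]; first by rewrite scale0r.
exact: Kcone.2.
Qed.

Lemma cone_sum (I : Type) (r : seq I) (P : pred I) (f : I -> V) :
  (forall i, P i -> K (f i)) -> K (\sum_(i <- r | P i) f i).
Proof. by move=> Kf; elim/big_ind: _ => // x y; exact: Kcone.1. Qed.

Lemma cone_segment x y (c eps : R) : K x -> K (x - eps *: y) -> 0 < eps ->
  0 <= c <= eps -> K (x - c *: y).
Proof.
move=> Kx Ky eps0 /andP[c0 ce].
have -> : x - c *: y = (1 - c / eps) *: x + (c / eps) *: (x - eps *: y).
  rewrite scalerBl scale1r scalerBr scalerA divfK ?gt_eqF// addrA.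
  by rewrite subrK.
apply: Kcone.1; apply: coneZ => //; last by rewrite divr_ge0// ltW.
by rewrite subr_ge0 ler_pdivrMr// mul1r.
Qed.

(** Replaces topology by algebra in what follows. For the converse, a free family in [K] spanning
    its linear hull controls all coordinates near [x]. *)
Lemma ri_coneP x :
  ri K x <-> K x /\ forall y, K y -> exists2 eps : R, 0 < eps & K (x - eps *: y).
Proof.
have bV : basis_of fullv (vbasis (fullv : {vspace V})) by exact: vbasisP.
split=> [[Kx /near_rowP[d d0 H]]|[Kx H]]; split=> //.
  move=> y Ky; pose yv := passmx.rVof (vbasis fullv) y.
  pose S : R := \sum_i `|yv 0 i : R|.
  have S0 : 0 <= S by apply: sumr_ge0.
  have eps0 : 0 < d / (1 + S) by rewrite divr_gt0// ltr_pwDl.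
  set eps := d / (1 + S) in eps0; exists eps => //.
  have := H (passmx.rVof (vbasis fullv) (x - eps *: y)); rewrite passmx.rVofK//; apply.
    move=> i; rewrite -!passmx.coord_rVof linearB linearZ/= !passmx.coord_rVof -/yv.
    rewrite addrAC subrr add0r normrN normrM.
    rewrite gtr0_norm//; apply: le_lt_trans (_ : eps * S < d).
      by rewrite ler_wpM2l ?(ltW eps0)// /S (bigD1 i)//= lerDl sumr_ge0.
    by rewrite /eps mulrAC ltr_pdivrMr ?ltr_pwDl// ltr_pM2l// ltrDr.
  (* [x - eps *: y] as an affine combination of [x], [y] and [0]. *)
  exists 3%N, (fun i => nth 0 [:: 1; - eps; eps] i), (fun i => nth 0 [:: x; y; 0] i).
  split; first by move=> [[|[|[|]]]].
    by rewrite !big_ord_recl big_ord0 /=; ring.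
  by rewrite !big_ord_recl big_ord0 /= scaler0 !addr0 scale1r scaleNr.
have [X [XK Xfree Xspan]] := exists_free_span K.
pose m := size X; pose T := in_tuple X.
have TK (i : 'I_m) : K T`_i by apply/XK/mem_nth.
have ex (i : 'I_m) : exists t : R, 0 < t /\ K (x - t *: T`_i).
  by have [t t0 Kt] := H _ (TK i); exists t.
have [eps epsP] := choice ex.
pose S (i : 'I_m) : R := \sum_(k < \dim (fullv : {vspace V})) `|coord T i (vbasis fullv)`_k|.
have S0 i : 0 <= S i by apply: sumr_ge0.
have [|d d0 /(_ d d0 (lexx _)) dP] := @small_pos _ _ xpredT eps
    (fun i => - (m.+1%:R * (1 + S i))).
  by move=> i _; case: (epsP i).
apply/near_rowP; exists d => // u ux [k [t [p [pK t1 uE]]]].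
set v := passmx.vecof _ u in uE *.
have xs : x \in <<X>>%VS by exact: Xspan.
have vs : v \in <<X>>%VS.
  by rewrite uE; apply: memv_suml => i _; apply/memvZ/Xspan/pK.
have zs : v - x \in <<T>>%VS by apply: memvB.
have zE : v - x = \sum_l (u 0 l - passmx.rVof (vbasis fullv) x 0 l) *: (vbasis fullv)`_l.
  under eq_bigr do rewrite scalerBl.
  by rewrite sumrB -/(passmx.vecof _ (passmx.rVof _ x)) passmx.rVofK.
pose c (i : 'I_m) := coord T i (v - x).
have cle i : m.+1%:R * `|c i| <= eps i.
  have cS : `|c i| <= d * (1 + S i).
    apply: (@le_trans _ _ (d * S i)); last by rewrite ler_wpM2l ?(ltW d0)// lerDr.
    rewrite /c zE linear_sum; apply: le_trans (ler_norm_sum _ _ _) _.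
    rewrite /S mulr_sumr; apply: ler_sum => l _; rewrite linearZ normrM ler_wpM2r//.
    exact: ltW (ux l).
  have := dP i isT.
  rewrite mulrN subr_gt0 => /ltW; apply: le_trans.
  by rewrite mulrCA ler_wpM2l// ler0n.
have vE : v = m.+1%:R^-1 *: x + \sum_i m.+1%:R^-1 *: (x + (m.+1%:R * c i) *: T`_i).
  under eq_bigr do rewrite scalerDr scalerA mulrA mulVf ?pnatr_eq0// mul1r.
  rewrite big_split /= addrA -(coord_span zs) sumr_const card_ord.
  have -> : m.+1%:R^-1 *: x + m.+1%:R^-1 *: x *+ m = x.
    by rewrite -mulrS scalerMnl -mulr_natr mulVf ?scale1r ?pnatr_eq0.
  by rewrite addrC subrK.
rewrite vE; apply: Kcone.1; first by apply: coneZ => //; rewrite invr_ge0 ler0n.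
apply: cone_sum => i _; apply: coneZ; first by rewrite invr_ge0 ler0n.
have [ei Ki] := epsP i.
have [c0|c0] := leP 0 (c i).
  by apply: Kcone.1 => //; apply: coneZ => //; rewrite mulr_ge0// ler0n.
have -> : m.+1%:R * c i = - (m.+1%:R * `|c i|) by rewrite ltr0_norm// mulrN opprK.
rewrite scaleNr; apply: cone_segment Ki _ _ => //.
by rewrite cle andbT mulr_ge0// ler0n.
Qed.

Lemma ri_sub x : ri K x -> K x. Proof. by case. Qed.

Lemma ri_add x y : ri K x -> K y -> ri K (x + y).
Proof.
move=> /ri_coneP[Kx H] Ky; apply/ri_coneP; split; first exact: Kcone.1.
by move=> z /H[eps eps0 Kz]; exists eps => //; rewrite addrAC; exact: Kcone.1.
Qed.

Lemma riZ (c : R) x : 0 < c -> ri K x -> ri K (c *: x).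
Proof.
move=> c0 /ri_coneP[Kx H]; apply/ri_coneP; split; first exact: Kcone.2.
move=> z /H[eps eps0 Kz]; exists (c * eps); first by rewrite mulr_gt0.
by rewrite -scalerA -scalerBr; exact: Kcone.2.
Qed.

(** For [d <= eps / 2], the point is the midpoint of [x] and a point of [K] lying twice as far along
    the segment. *)
Lemma ri_subr x y : ri K x -> K y ->
  exists2 eps : R, 0 < eps & forall d, 0 <= d <= eps -> ri K (x - d *: y).
Proof.
move=> xri Ky; have [Kx /(_ _ Ky)[eps eps0 Kz]] := (ri_coneP x).1 xri.
exists (eps / 2); first by rewrite divr_gt0.
move=> d /andP[d0 de].
have -> : x - d *: y = 2^-1 *: x + 2^-1 *: (x - (2 * d) *: y).
  by rewrite scalerBr scalerA mulKf// addrA -scalerDl -[2^-1]mul1r -splitr scale1r.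
apply: ri_add; first by apply: riZ; rewrite // invr_gt0.
apply: coneZ; first by rewrite invr_ge0.
by apply: cone_segment Kz eps0 _ => //; apply/andP; split; lra.
Qed.

Lemma ri_perturb x y z : ri K x -> K y -> K z ->
  exists2 eps : R, 0 < eps & forall d, 0 <= d <= eps -> ri K (x + d *: (y - z)).
Proof.
move=> xri Ky Kz; have [eps eps0 H] := ri_subr xri Kz; exists eps => // d de.
rewrite scalerBr addrCA addrC; apply: ri_add; first exact: H.
by apply: coneZ => //; case/andP: de.
Qed.

End RelativeInterior.

(** * Faces of invariant cones *)

Section FaceGeometry.
Variables (R : realType) (V : vectType R) (n : nat).
Variables (e : 'I_n -> {scalar V}) (a : 'I_n -> V).
Local Notation act := (word_act e a).
Local Notation refl := (simple_refl e a).
Let A : 'M[R]_n := \matrix_(i, j) e i (a j).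
Local Notation inJ J w := (all (fun j => j \in J) w).

Definition on_facet (J : {set 'I_n}) : set V :=
  [set x | (forall i, i \in J -> e i x = 0) /\ (forall i, i \notin J -> 0 < e i x)].

Hypothesis rd : root_datum e a.
Let ea := rd_two rd.
Let Aoff i j : i != j -> A i j <= 0.
Proof. by move=> ij; rewrite mxE; exact: (cartan_offdiag_le0 rd). Qed.

(** [U0] and [Us] play the roles of [upsilon_sub] and [upsilon_sup] of the face [F]. *)
Variables (F : set V) (U0 Us : {set 'I_n}).
Hypotheses (Fcone : convex_cone F) (F0 : F 0).
Hypothesis Ftits : F `<=` in_tits_cone e a.
Hypothesis U0P : forall i, reflect (forall x, F x -> e i x = 0) (i \in U0).
Hypothesis Us_refl : forall i x, i \in Us -> F x -> F (refl i x).
Hypothesis Us_disj : forall i, i \in Us -> i \notin U0.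
Hypothesis Us_ri : forall i x, ri F x -> e i x = 0 -> i \notin U0 -> i \in Us.

Lemma ri_facet_finite_type x : ri F x -> in_closed_chamber e x ->
  exists J : {set 'I_n}, [/\ J \subset Us, finite_type A J & on_facet (U0 :|: J)%SET x].
Proof.
move=> xri Cx; have Fx := ri_sub xri.
pose J := finset (fun i => (e i x == 0) && (i \notin U0)).
exists J; split.
- by apply/fintype.subsetP => i; rewrite inE => /andP[/eqP xi]; exact: Us_ri xi.
- have [//|[y [y0 yJ [k yk] yA]]] := finite_type_alternative J Aoff; exfalso.
  have yA' j : \sum_i y i * e i (a j) <= 0.
    have E : \sum_i y i * e i (a j) = \sum_(i in J) y i * A i j.
      rewrite [RHS]big_mkcond; apply: eq_bigr => i _; rewrite mxE.
      by case: ifPn => // /yJ->; rewrite mul0r.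
    rewrite E; have [/yA//|jJ] := boolP (j \in J).
    apply: sumr_le0 => i iJ; rewrite mulr_ge0_le0// Aoff//.
    by apply: contraNneq jJ => <-.
  have T := tits_cone_antidominant rd y0 yA'.
  have x0 : \sum_i y i * e i x = 0.
    apply: big1 => i _; have [|/yJ->] := boolP (i \in J); last by rewrite mul0r.
    by rewrite inE => /andP[/eqP-> _]; rewrite mulr0.
  have kJ : k \in J by apply: contraNT yk => /yJ->.
  suff : k \in U0 by move: kJ; rewrite inE => /andP[_ /negPf->].
  apply/U0P => z Fz; have [z0 zE] := T _ (Ftits Fz); apply: zE => //.
  (* The functional vanishes at [x] and is nonnegative at [x - eps *: z], so it is nonpositive at
     [z]. *)
  have [eps eps0 H] := ri_subr Fcone F0 xri Fz.
  have /ri_sub/Ftits/T[+ _] : ri F (x - eps *: z) by apply: H; rewrite lexx ltW.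
  under eq_bigr do rewrite linearB evalZ mulrBr mulrCA.
  rewrite sumrB x0 -mulr_sumr sub0r oppr_ge0 pmulr_rle0// => z0'.
  by apply/eqP; rewrite eq_le z0' z0.
- split=> i; rewrite !inE.
    by case/orP => [/U0P/(_ _ Fx)//|/andP[/eqP]].
  rewrite negb_or negb_and => /andP[iU0]; rewrite iU0 orbF => xi.
  by rewrite lt_neqAle eq_sym xi Cx.
Qed.

(** Each [a j] is a positive multiple of [x - refl j x] for some [x] in [F] with [e j x > 0]; a
    point with negative value is first reflected. *)
Lemma root_direction (J : {set 'I_n}) (u : 'I_n -> R) :
  J \subset Us -> (forall j, j \in J -> 0 < u j) ->
  exists y z, [/\ F y, F z & \sum_(j in J) u j *: a j = y - z].
Proof.
move=> JU u0.
have ex j : exists xt : V, j \in J -> F xt /\ 0 < e j xt.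
  have [jJ|jJ] := boolP (j \in J); last by exists 0.
  have jU := fintype.subsetP JU _ jJ.
  have /U0P/existsNP[x /not_implyP[Fx /eqP xj]] := Us_disj jU.
  have [xp|xn] := ltP 0 (e j x); first by exists x.
  exists (refl j x) => _; split; first exact: Us_refl.
  by rewrite eval_refl_id// oppr_gt0 lt_neqAle xj.
have [f fP] := choice ex.
exists (\sum_(j in J) (u j / e j (f j)) *: f j),
       (\sum_(j in J) (u j / e j (f j)) *: refl j (f j)); split.
- apply: cone_sum => // j jJ; have [Ff f0] := fP _ jJ.
  by apply: Fcone.2 => //; rewrite divr_gt0 ?u0.
- apply: cone_sum => // j jJ; have [Ff f0] := fP _ jJ.
  apply: Fcone.2; first by rewrite divr_gt0 ?u0.
  exact/Us_refl/Ff/(fintype.subsetP JU).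
- rewrite -sumrB; apply: eq_bigr => j jJ; have [Ff f0] := fP _ jJ.
  by rewrite -scalerBr /simple_refl subKr scalerA divfK// gt_eqF.
Qed.

Lemma facet_push (J : {set 'I_n}) (u : 'I_n -> R) x :
  J \subset Us -> (forall j, j \in J -> 0 < u j) ->
  (forall i, i \in J -> 0 < \sum_(j in J) A i j * u j) ->
  ri F x -> on_facet (U0 :|: J)%SET x ->
  exists d, ri F (x + d *: \sum_(j in J) u j *: a j) /\
    on_facet U0 (x + d *: \sum_(j in J) u j *: a j).
Proof.
move=> JU u0 Au xri [x0 xp].
have [y [z [Fy Fz bE]]] := root_direction JU u0.
set b := \sum_(j in J) _ in bE *.
have ebE i : e i b = \sum_(j in J) A i j * u j.
  by rewrite linear_sum; apply: eq_bigr => j _; rewrite evalZ mxE mulrC.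
have [d1 d10 H1] := ri_perturb Fcone F0 xri Fy Fz.
have [d2 d20 H2] := small_pos (fun i => e i b) xp.
pose d := Num.min d1 d2.
have d0 : 0 < d by rewrite lt_min d10.
have dri : ri F (x + d *: b) by rewrite bE; apply: H1; rewrite ltW//= ge_min lexx.
exists d; split => //; split=> i iU; first by have /U0P := iU; apply; exact: ri_sub.
rewrite linearD evalZ; have [iJ|iJ] := boolP (i \in J).
  by rewrite x0 ?inE ?iJ ?orbT// add0r mulr_gt0// ebE Au.
by apply: H2; rewrite ?inE ?negb_or ?iU// ge_min lexx orbT.
Qed.

Lemma facet_U0_exists x : ri F x -> in_closed_chamber e x ->
  exists2 y, ri F y & on_facet U0 y.
Proof.
move=> xri Cx; have [J [JU [u [u0 Au]] xJ]] := ri_facet_finite_type xri Cx.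
have [d [dri dU]] := facet_push JU u0 Au xri xJ.
by exists (x + d *: \sum_(j in J) u j *: a j).
Qed.

(** Subtracting a little of a point [y] of [ri F] on the facet of [U0] from an interior point of the
    section shows that the latter is in [ri F] and positive off [U0]. Conversely, small subtractions
    preserve both conditions. *)
Lemma ri_chamber_section x0 : ri F x0 -> in_closed_chamber e x0 ->
  ri (F `&` in_closed_chamber e) = ri F `&` on_facet U0.
Proof.
move=> x0ri Cx0; have [y yri [y0 yp]] := facet_U0_exists x0ri Cx0.
have FC : convex_cone (F `&` in_closed_chamber e).
  split=> [x z [Fx Cx] [Fz Cz]|r x r0 [Fx Cx]]; split.
  - exact: Fcone.1.
  - by move=> i; rewrite linearD addr_ge0.
  - exact: Fcone.2.
  - by move=> i; rewrite evalZ mulr_ge0// ltW.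
have FC0 : (F `&` in_closed_chamber e) 0 by split => // i; rewrite linear0.
have yC : in_closed_chamber e y.
  by move=> i; have [/y0->//|/yp/ltW] := boolP (i \in U0).
apply/seteqP; split=> x.
  move=> /(ri_coneP FC FC0)[[Fx Cx] /(_ y)[]]; first by split => //; exact: ri_sub.
  move=> eps eps0 [Fxy Cxy].
  have xE : x = eps *: y + (x - eps *: y) by rewrite addrC subrK.
  split; first by rewrite xE; apply: ri_add => //; exact: riZ.
  split=> i iU; first by have /U0P := iU; apply.
  by rewrite xE linearD evalZ ltr_pwDl// mulr_gt0 ?yp.
move=> [xri [x0' xp]]; apply/(ri_coneP FC FC0).
have Fx := ri_sub xri.
split.
  by split => // i; have [/x0'->//|/xp/ltW] := boolP (i \in U0).
move=> z [Fz Cz].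
have [d1 d10 H1] := ri_subr Fcone F0 xri Fz.
have [d2 d20 H2] := small_pos (fun i => - e i z) xp.
pose d := Num.min d1 d2.
have d0 : 0 < d by rewrite lt_min d10.
exists d => //; split; first by apply: (@ri_sub _ _ F); apply: H1; rewrite ltW//= ge_min lexx.
move=> i; rewrite linearB evalZ; have [iU|iU] := boolP (i \in U0).
  by have /U0P H := iU; rewrite !H// mulr0 subrr.
by rewrite -mulrN ltW// H2// ge_min lexx orbT.
Qed.

(** * The averaging map on a face *)

Section Mid.
Variables (J : {set 'I_n}) (midJ : V -> V) (ws : seq (seq 'I_n)).
Hypotheses (JU : J \subset Us) (Jfin : finite_type A J).
Hypothesis ws0 : (0 < size ws)%N.
Hypothesis wsJ : forall w, w \in ws -> inJ J w.
Hypothesis midE : forall x, midJ x = (size ws)%:R^-1 *: \sum_(w <- ws) act w x.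
Hypothesis mid_refl : forall j x, j \in J -> midJ (refl j x) = midJ x.
Hypothesis refl_mid : forall j x, j \in J -> refl j (midJ x) = midJ x.

Lemma refl_ri j x : j \in Us -> ri F x -> ri F (refl j x).
Proof.
move=> jU /(ri_coneP Fcone F0)[Fx H]; apply/(ri_coneP Fcone F0).
split; first exact: Us_refl.
move=> y Fy; have [eps eps0 Fe] := H _ (Us_refl jU Fy); exists eps => //.
by have := Us_refl jU Fe; rewrite linearB linearZ/= reflK.
Qed.

Lemma act_ri w x : inJ J w -> ri F x -> ri F (act w x).
Proof.
move=> wJ xri; elim: w wJ => [//|j w IH] /= /andP[jJ wJ].
by apply: refl_ri; [exact: (fintype.subsetP JU) | exact: IH].
Qed.

Lemma mid_ri x : ri F x -> ri F (midJ x).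
Proof.
move=> xri; rewrite midE; apply: riZ => //; first by rewrite invr_gt0 ltr0n.
case: ws ws0 wsJ => [//|w l] _ wJ; rewrite big_cons.
apply: ri_add => //; first by apply: act_ri => //; apply: wJ; rewrite inE eqxx.
elim: l wJ => [|v l IH] wJ; first by rewrite big_nil.
rewrite big_cons; apply: Fcone.1.
  by apply: (@ri_sub _ _ F); apply: act_ri => //; apply: wJ; rewrite !inE eqxx orbT.
apply: IH => t; rewrite inE => tl; apply: wJ; rewrite !inE.
by case/orP: tl => ->; rewrite ?orbT.
Qed.

Lemma average_const (x : V) : (size ws)%:R^-1 *: \sum_(w <- ws) x = x.
Proof.
rewrite big_const_seq count_predT iter_addr_0 -scalerMnr scalerMnl -mulr_natr mulVf ?scale1r//.
by rewrite pnatr_eq0 -lt0n.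
Qed.

Lemma mid_id x : (forall j, j \in J -> e j x = 0) -> midJ x = x.
Proof.
move=> x0; rewrite midE big_seq (eq_bigr (fun=> x)) => [|w /wsJ wJ]; last first.
  exact: (act_fix a wJ x0).
by rewrite -big_seq average_const.
Qed.

Lemma mid_linear c x y : midJ (c *: x + y) = c *: midJ x + midJ y.
Proof.
rewrite !midE scalerA mulrC -scalerA -scalerDr; congr (_ *: _).
by rewrite scaler_sumr -big_split; apply: eq_bigr => w _; rewrite linearP.
Qed.

Lemma mid_root j : j \in J -> midJ (a j) = 0.
Proof.
move=> jJ; have := mid_refl (a j) jJ; rewrite refl_root// midE.
under eq_bigr do rewrite linearN.
rewrite sumrN scalerN -midE => /eqP; rewrite eq_sym -addr_eq0 -mulr2n -scaler_nat.
by rewrite scaler_eq0 pnatr_eq0 => /eqP.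
Qed.

Let root_comb (z : V) := exists c : 'I_n -> R, z = \sum_(j in J) c j *: a j.

(** Each [x - act w x] telescopes into multiples of the [a j] with [j] a letter of [w]. *)
Lemma mid_root_comb x : root_comb (x - midJ x).
Proof.
have combD y z : root_comb y -> root_comb z -> root_comb (y + z).
  move=> [c ->] [d ->]; exists (fun j => c j + d j).
  by rewrite -big_split; apply: eq_bigr => j _; rewrite scalerDl.
have combZ r y : root_comb y -> root_comb (r *: y).
  move=> [c ->]; exists (fun j => r * c j).
  by rewrite scaler_sumr; apply: eq_bigr => j _; rewrite scalerA.
have comb0 : root_comb 0 by exists (fun=> 0); rewrite big1// => j _; rewrite scale0r.
have combact w : inJ J w -> root_comb (x - act w x).
  elim: w => [_|j w IH] /=; first by rewrite subrr.
  move=> /andP[jJ /IH wx]; rewrite /simple_refl opprB addrCA addrC; apply: combD => //.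
  exists (fun k => (k == j)%:R * e j (act w x)); rewrite (bigD1 j)//= eqxx mul1r.
  by rewrite big1 ?addr0// => k /andP[_ /negPf->]; rewrite mul0r scale0r.
have -> : x - midJ x = (size ws)%:R^-1 *: \sum_(w <- ws) (x - act w x).
  rewrite sumrB scalerBr -midE; congr (_ - _).
  by rewrite average_const.
apply: combZ; rewrite big_seq; elim/big_ind: _ => // w /wsJ; exact: combact.
Qed.

(** Writing [x - midJ x] as the sum of the [c j *: a j], the block of [A] on [J] maps [c] to the
    positive values of [x], so [c >= 0]; hence the values outside [J] do not decrease. *)
Lemma mid_facet x : ri F x -> on_facet U0 x -> on_facet (U0 :|: J)%SET (midJ x).
Proof.
move=> xri [x0 xp]; have Fm := ri_sub (mid_ri xri).
have m0 j : j \in J -> e j (midJ x) = 0.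
  by move=> jJ; apply: (refl_idE ea); exact: refl_mid.
have [c cE] := mid_root_comb x.
have eE i : \sum_(j in J) A i j * c j = e i x - e i (midJ x).
  by rewrite -linearB cE linear_sum; apply: eq_bigr => j _; rewrite evalZ mxE mulrC.
have JU0 i : i \in J -> i \notin U0 by move=> /(fintype.subsetP JU)/Us_disj.
have c0 j : j \in J -> 0 <= c j.
  apply: (finite_type_monotone Aoff Jfin) => i iJ.
  by rewrite eE m0// subr0 ltW// xp// JU0.
split=> i; first by rewrite inE => /orP[/U0P/(_ _ Fm)//|/m0].
rewrite inE negb_or => /andP[iU iJ]; apply: lt_le_trans (xp _ iU) _.
rewrite -subr_le0 -eE; apply: sumr_le0 => j jJ; rewrite mulr_le0_ge0 ?c0// Aoff//.
by apply: contraNneq iJ => ->.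
Qed.

Lemma mid_image : midJ @` (ri F `&` on_facet U0) = ri F `&` on_facet (U0 :|: J)%SET.
Proof.
apply/seteqP; split=> [_ [x [xri xU] <-]|x [xri xU]].
  by split; [exact: mid_ri | exact: mid_facet].
have [u [u0 Au]] := Jfin.
have [d [dri dU]] := facet_push JU u0 Au xri xU.
(* The pushed point is a preimage of [x]: [midJ] kills each [a j] with [j] in [J] and fixes [x]. *)
exists (x + d *: \sum_(j in J) u j *: a j) => //.
have midD c y z : midJ (y + c *: z) = midJ y + c *: midJ z.
  by rewrite addrC mid_linear addrC.
have mid_sum : midJ (\sum_(j in J) u j *: a j) = 0.
  elim/big_rec: _ => [|j y jJ y0].
    by rewrite mid_id// => j _; rewrite linear0.
  by rewrite addrC midD y0 mid_root// scaler0 addr0.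
rewrite midD mid_sum scaler0 addr0 mid_id// => j jJ.
by apply: xU.1; rewrite inE jJ orbT.
Qed.

End Mid.
End FaceGeometry.

(** * Linear Coxeter systems *)

Lemma closed_rayE (R : realType) (V : vectType R) (S : set V) x y : closed_ray S -> S x -> x != 0 ->
  S y <-> exists2 r : R, 0 <= r & y = r *: x.
Proof.
move=> [v v0 ->] [r /= r0 <-] rv0.
have rn0 : r != 0 by apply: contraNneq rv0 => ->; rewrite scale0r.
split=> [[t /= t0 <-]|[t t0 ->]].
  exists (t / r); first by rewrite divr_ge0.
  by rewrite scalerA divfK.
by exists (t * r); rewrite ?scalerA//= mulr_ge0.
Qed.

Lemma is_span_inj (R : realType) (V : vectType R) (S : set V) (U U' : {vspace V}) :
  is_span S U -> is_span S U' -> U = U'.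
Proof.
move=> [SU minU] [SU' minU']; apply/eqP; rewrite eqEsubv.
by rewrite minU// minU'.
Qed.

Section Evaluation.
Variables (R : realType) (h : vectType R).

Definition evalh (x : h) (l : 'Hom(h, R^o)) : R := l x.

Lemma evalh_linear x : linear_for *%R (evalh x).
Proof. by move=> c l m; rewrite /evalh add_lfunE scale_lfunE. Qed.
HB.instance Definition _ x :=
  GRing.isLinear.Build R 'Hom(h, R^o) R *%R (evalh x) (evalh_linear x).

(* [evalh], typed with values in [R^o] so that it has a kernel. *)
Definition evalho (x : h) (l : 'Hom(h, R^o)) : R^o := l x.

Lemma evalho_linear x : linear (evalho x).
Proof. exact: evalh_linear. Qed.
HB.instance Definition _ x :=
  GRing.isLinear.Build R 'Hom(h, R^o) R^o *:%R (evalho x) (evalho_linear x).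

Definition annihilator (x : h) : {vspace 'Hom(h, R^o)} := lker (linfun (evalho x)).

Lemma mem_annihilator x (l : 'Hom(h, R^o)) : (l \in annihilator x) = (l x == 0).
Proof. by rewrite memv_ker lfunE. Qed.

Lemma dim_annihilator x (l : 'Hom(h, R^o)) : l x != 0 ->
  (\dim (annihilator x)).+1 = \dim (fullv : {vspace 'Hom(h, R^o)}).
Proof.
move=> lx; have := limg_ker_dim (linfun (evalho x)) fullv; rewrite capfv -/(annihilator x).
have -> : \dim (linfun (evalho x) @: fullv) = 1%N; last by rewrite addn1.
apply/eqP; rewrite eqn_leq; apply/andP; split.
  by apply: leq_trans (dimvS (subvf _)) _; rewrite dimvf.
rewrite lt0n dimv_eq0; apply: contraNneq lx => E.
have : linfun (evalho x) l \in (linfun (evalho x) @: fullv)%VS by exact: memv_img (memvf _).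
by rewrite E memv0 lfunE.
Qed.

End Evaluation.

(** * From a linear Coxeter system to a root datum *)

Section Translation.
Variables (R : realType) (h : vectType R) (n : nat).
Variables (H : 'I_n -> set h) (L : 'I_n -> set 'Hom(h, R^o)).
Hypothesis lcs : linear_coxeter_system H L.
Variables (hh : 'I_n -> h) (alpha : 'I_n -> 'Hom(h, R^o)).
Hypotheses (hhH : forall i, H i (hh i)) (alphaL : forall i, L i (alpha i)).
Hypothesis alpha_hh : forall i, alpha i (hh i) = 2.

Let e i : {scalar 'Hom(h, R^o)} := evalh (hh i).
Let ea i : e i (alpha i) = 2. Proof. exact: alpha_hh. Qed.
Local Notation act := (word_act e alpha).
Local Notation refl := (simple_refl e alpha).

Lemma hh_neq0 i : hh i != 0.
Proof.
apply/eqP => hi; have := alpha_hh i; rewrite hi linear0 => /esym/eqP.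
by rewrite pnatr_eq0.
Qed.

Lemma alpha_neq0 i : alpha i != 0.
Proof.
apply/eqP => ai; have := alpha_hh i; rewrite ai zero_lfunE => /esym/eqP.
by rewrite pnatr_eq0.
Qed.

Lemma HE i x : H i x <-> exists2 r : R, 0 <= r & x = r *: hh i.
Proof. exact: closed_rayE (lcs_rayH lcs i) (hhH i) (hh_neq0 i). Qed.

Lemma ray_ge0E i l : ray_ge0 (H i) l <-> 0 <= e i l.
Proof.
split=> [|l0 x /HE[r r0 ->]]; first exact.
by rewrite linearZ/= mulr_ge0.
Qed.

Lemma ray_gt0E i l : ray_gt0 (H i) l <-> 0 < e i l.
Proof.
split=> [Hl|l0 x /HE[r r0 ->]]; first exact: Hl (hh_neq0 i).
rewrite scaler_eq0 negb_or linearZ/= => /andP[rn0 _]; rewrite mulr_gt0//.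
by rewrite lt_neqAle eq_sym rn0.
Qed.

Lemma ray_eq0E i l : ray_eq0 (H i) l <-> e i l = 0.
Proof.
split=> [|l0 x /HE[r r0 ->]]; first exact.
by rewrite linearZ/= [l (hh i)]l0 scaler0.
Qed.

(** Whatever [xget] picks, its values are forced on the wall and on [alpha i], which together
    span. *)
Lemma reflectionE i l : reflection (H i) (L i) l = refl i l.
Proof.
have Hs : is_reflection (H i) (L i) (linfun (refl i)).
  split=> [m /ray_eq0E m0|b]; first by rewrite lfunE /= refl_id.
  move=> /(closed_rayE _ (lcs_rayL lcs i) (alphaL i) (alpha_neq0 i))[r r0 ->].
  by rewrite lfunE linearZ/= refl_root// scalerN.
have [s0 sa] := @xgetPex _ 0 _ (ex_intro _ _ Hs); rewrite -/(reflection (H i) (L i)) in s0 sa.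
have lE : l = (e i l / 2) *: alpha i + (l - (e i l / 2) *: alpha i) by rewrite addrC subrK.
have m0 : e i (l - (e i l / 2) *: alpha i) = 0 by rewrite linearB evalZ ea divfK ?subrr.
move: lE m0; move: (e i l / 2) => c; move: (l - c *: alpha i) => m -> m0.
rewrite linearP/= sa// s0; last exact/ray_eq0E.
by rewrite [RHS]linearP/= refl_root// [refl i m]refl_id.
Qed.

Lemma generated_words (P : set 'I_n) (s : 'End('Hom(h, R^o))) :
  generated [set reflection (H j) (L j) | j in P] s <->
  exists2 w, (forall j, j \in w -> P j) & forall l, s l = act w l.
Proof.
split=> [|[w wP]].
  elim=> [|f [j Pj <-]|f g _ [w wP wE] _ [v vP vE]|f _ [w wP wE]].
  - by exists [::] => // l; rewrite id_lfunE.
  - exists [:: j] => [k|l]; first by rewrite inE => /eqP->.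
    by rewrite reflectionE.
  - exists (w ++ v) => [k|l]; first by rewrite mem_cat => /orP[/wP|/vP].
    by rewrite comp_lfunE wE vE act_cat.
  - exists (rev w) => [k|l]; first by rewrite mem_rev => /wP.
    have fK : cancel f (f^-1)%VF.
      apply: lker0_lfunK; apply/lker0P => x y; rewrite !wE.
      exact: (can_inj (act_revK ea w)).
    by rewrite -[in LHS](act_Krev ea w l) -wE fK.
elim: w s wP => [|j w IH] s wP sE.
  by rewrite (_ : s = \1%VF); [exact: generated1 | apply/lfunP => l; rewrite sE id_lfunE].
have [w' w'P w'E] : exists2 s', generated [set reflection (H j) (L j) | j in P] s' &
    forall l, s' l = act w l.
  exists (linfun (act w)) => [|l]; last by rewrite lfunE.
  by apply: IH => [k kw|l]; [apply: wP; rewrite inE kw orbT | rewrite lfunE].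
rewrite (_ : s = (reflection (H j) (L j) \o w')%VF).
  apply: generatedM => //; apply: generated_base; exists j => //.
  by apply: wP; rewrite inE eqxx.
by apply/lfunP => l; rewrite comp_lfunE w'E reflectionE sE.
Qed.

Lemma parabolic_words (J : {set 'I_n}) s : parabolic H L J s <->
  exists2 w, all (fun j => j \in J) w & forall l, s l = act w l.
Proof.
by split=> [/generated_words|] [w wJ wE]; [|apply/generated_words]; exists w => //;
  apply/allP.
Qed.

Lemma coxeter_group_words s : coxeter_group H L s <-> exists w, forall l, s l = act w l.
Proof.
split=> [/generated_words[w _ wE]|[w wE]]; first by exists w.
by apply/generated_words; exists w.
Qed.

Lemma closed_chamberE : closed_chamber H = in_closed_chamber e.
Proof.
apply/seteqP; split=> l Hl.
  by move=> i; apply/ray_ge0E/Hl.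
by move=> i _; apply/ray_ge0E/Hl.
Qed.

Lemma chamberE : chamber H = in_chamber e.
Proof.
apply/seteqP; split=> l Hl.
  by move=> i; apply/ray_gt0E/Hl.
by move=> i _; apply/ray_gt0E/Hl.
Qed.

Lemma tits_coneE : tits_cone H L `<=` in_tits_cone e alpha.
Proof.
move=> _ [s /coxeter_group_words[w wE] [l lC <-]]; exists w, l; split => //.
by rewrite -closed_chamberE.
Qed.

(** If [e i] vanished on the closed chamber, the latter would not span; points with [e i] positive
    are summed over [i]. *)
Lemma chamber_point : exists x, in_chamber e x.
Proof.
have pt i : exists x, in_closed_chamber e x /\ 0 < e i x.
  apply: contrapT => Hn; have [_ Cmin] := lcs_span lcs.
  have : (fullv <= annihilator (hh i))%VS.
    apply: Cmin => l; rewrite closed_chamberE => Cl.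
    rewrite mem_annihilator eq_le Cl andbT leNgt; apply/negP => l0.
    by apply: Hn; exists l.
  move=> /subvP/(_ (alpha i) (memvf _)); rewrite mem_annihilator alpha_hh.
  by rewrite pnatr_eq0.
have [f fP] := choice pt.
exists (\sum_i f i) => i; rewrite linear_sum (bigD1 i)//=.
apply: ltr_pwDl; first by case: (fP i).
by apply: sumr_ge0 => k _; case: (fP k) => /(_ i).
Qed.

(** If [e k] vanished on the face of [i], the span of this face, of codimension 1, would be the
    kernel of both [e i] and [e k], and the faces of [i] and [k] would coincide. *)
Lemma wall_point i : exists2 p, e i p = 0 & forall k, k != i -> 0 < e k p.
Proof.
have pt k : exists p, k != i -> [/\ in_closed_chamber e p, e i p = 0 & 0 < e k p].
  have [ki|] := eqVneq k i; first by exists 0.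
  move=> ki; apply: contrapT => Hn.
  have Hik p : in_closed_chamber e p -> e i p = 0 -> e k p = 0.
    move=> Cp p0; apply/eqP; rewrite eq_le Cp andbT leNgt; apply/negP => pk.
    by apply: Hn; exists p.
  have [_ [UK [UF [KU FU dimU]]]] :=
    (lcs_faceP lcs (closed_chamber H `&` ray_eq0 (H i))).2 (ex_intro _ i erefl).
  have UKE := is_span_inj KU (lcs_span lcs).
  have dimi j : (\dim (annihilator (hh j))).+1 = (\dim UF).+1.
    by rewrite -dimU UKE (@dim_annihilator _ _ _ (alpha j))// alpha_hh pnatr_eq0.
  have sub j : (forall p, in_closed_chamber e p -> e i p = 0 -> e j p = 0) ->
      UF = annihilator (hh j).
    move=> Hj; apply/eqP; rewrite eqEdim -ltnS dimi leqnn andbT.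
    apply: FU.2 => l [+ /ray_eq0E l0]; rewrite closed_chamberE mem_annihilator => Cl.
    by apply/eqP/Hj.
  have annE : annihilator (hh i) = annihilator (hh k) by rewrite -!sub.
  move/eqP: ki; apply; apply: (lcs_face_inj lcs).
  have eqE l : (e k l == 0) = (e i l == 0).
    by rewrite /e /evalh -!mem_annihilator annE.
  apply/seteqP; split=> l [Cl /ray_eq0E/eqP l0]; split=> //; apply/ray_eq0E/eqP.
    by rewrite -eqE.
  by rewrite eqE.
have [f fP] := choice pt.
exists (\sum_(k | k != i) f k).
  by rewrite linear_sum big1// => k /fP[].
move=> k ki; rewrite linear_sum (bigD1 k)//=.
apply: ltr_pwDl; first by case: (fP k ki).
by apply: sumr_ge0 => j /andP[/fP[Cj _ _] _]; exact: Cj.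
Qed.

Lemma lcs_root_datum : root_datum e alpha.
Proof.
split.
- exact: alpha_hh.
- exact: chamber_point.
- exact: wall_point.
- move=> w x Cx Cwx y; pose s := linfun (act w).
  have sE l : s l = act w l by rewrite lfunE.
  have sW : coxeter_group H L s by apply/coxeter_group_words; exists w.
  have [s1|s1] := eqVneq s \1%VF; first by rewrite -sE s1 id_lfunE.
  have := lcs_disjoint lcs sW s1 => /seteqP[/(_ (act w x)) Hd _]; exfalso.
  by apply: Hd; rewrite chamberE; split => //; exists x.
Qed.

Section MidWords.
Variable J : {set 'I_n}.
Hypothesis Jfin : finite_type (coxeter_mx hh alpha) J.
Local Notation P := (parabolic H L J).

(** On an infinite group [fset_set] would be empty and [mid] zero; finiteness makes [mid] a genuine
    average. *)
Lemma parabolic_finite : finite_set P.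
Proof.
have [ws wsP] := finite_type_words lcs_root_datum Jfin.
pose f w : 'End('Hom(h, R^o)) := linfun (act w).
apply: (@sub_finite_set _ _ (f @` [set` ws])); last exact/finite_image/finite_seq.
move=> s /parabolic_words[w wJ wE]; have [w' w'ws w'E] := wsP w wJ.
by exists w' => //; apply/lfunP => l; rewrite lfunE wE w'E.
Qed.

Lemma mem_parabolic s : s \in fset_set P <-> P s.
Proof. by rewrite in_fset_set ?inE//; exact: parabolic_finite. Qed.

Lemma parabolic_perm (f : 'End('Hom(h, R^o)) -> 'End('Hom(h, R^o))) :
  injective f -> (forall s, P s -> P (f s)) ->
  perm_eq [seq f s | s <- fset_set P] (fset_set P).
Proof.
move=> finj fP; have u : uniq [seq f s | s <- fset_set P] by rewrite map_inj_uniq// fset_uniq.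
have sub : {subset [seq f s | s <- fset_set P] <= fset_set P}.
  by move=> _ /mapP[s /mem_parabolic sP ->]; apply/mem_parabolic/fP.
apply: uniq_perm; [exact: u | exact: fset_uniq |].
by have [|//] := uniq_min_size u sub; rewrite size_map.
Qed.

Lemma parabolic_refl j : j \in J -> P (reflection (H j) (L j)).
Proof. by move=> jJ; apply: generated_base; exists j. Qed.

Let reflectionK j : (reflection (H j) (L j) \o reflection (H j) (L j))%VF = \1%VF.
Proof.
by apply/lfunP => l; rewrite comp_lfunE !reflectionE reflK// id_lfunE.
Qed.

Lemma mid_refl j x : j \in J -> mid H L J (refl j x) = mid H L J x.
Proof.
move=> jJ; rewrite /mid; congr (_ *: _).
pose t := reflection (H j) (L j).
rewrite -[RHS](perm_big _ (@parabolic_perm (fun s => s \o t)%VF _ _)) /=.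
- by rewrite big_map; apply: eq_bigr => s _; rewrite comp_lfunE reflectionE.
- by move=> s s' /(congr1 (fun g => g \o t)%VF); rewrite -!comp_lfunA reflectionK !comp_lfun1r.
- by move=> s sP; apply: generatedM => //; exact: parabolic_refl.
Qed.

Lemma refl_mid j x : j \in J -> refl j (mid H L J x) = mid H L J x.
Proof.
move=> jJ; rewrite /mid linearZ/=; congr (_ *: _); rewrite linear_sum.
pose t := reflection (H j) (L j).
rewrite -[RHS](perm_big _ (@parabolic_perm (fun s => t \o s)%VF _ _)) /=.
- by rewrite big_map; apply: eq_bigr => s _; rewrite comp_lfunE reflectionE.
- by move=> s s' /(congr1 (fun g => t \o g)%VF); rewrite !comp_lfunA reflectionK !comp_lfun1l.
- by move=> s sP; apply: generatedM => //; exact: parabolic_refl.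
Qed.

Lemma mid_words : exists ws, [/\ (0 < size ws)%N,
  forall w, w \in ws -> all (fun j => j \in J) w &
  forall x, mid H L J x = (size ws)%:R^-1 *: \sum_(w <- ws) act w x].
Proof.
have ex s : exists w, P s -> all (fun j => j \in J) w /\ forall l, s l = act w l.
  have [/parabolic_words[w wJ wE]|] := pselect (P s); first by exists w.
  by exists [::].
have [f fP] := choice ex.
exists [seq f s | s <- fset_set P]; split.
- rewrite size_map cardfs_gt0; apply/fset0Pn; exists \1%VF.
  by apply/mem_parabolic; exact: generated1.
- by move=> _ /mapP[s /mem_parabolic/fP[fJ _] ->].
- move=> x; rewrite /mid size_map big_map; congr (_ *: _).
  by apply: eq_big_seq => s /mem_parabolic/fP[_ ->].
Qed.

End MidWords.

(** * Faces of an invariant subcone *)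

Section Faces.
Variables (Y F : set 'Hom(h, R^o)).
Hypotheses (Ycone : convex_cone Y) (Y0 : Y 0).
Hypothesis Yinv : forall s, coxeter_group H L s -> s @` Y = Y.
Hypothesis FY : Fa Y F.

Let Fcone : convex_cone F. Proof. by case: FY => -[]. Qed.
Let F_sub : F `<=` Y. Proof. by case: FY => -[]. Qed.

Lemma face0 : F 0.
Proof.
case: FY => -[_ FYs Fface] [x Fx]; apply: contrapT => F0.
have [|_] := Fface 0 x _ (FYs _ Fx); first by [].
by rewrite add0r.
Qed.

Lemma face_summand x y : Y x -> Y y -> F (x + y) -> F x.
Proof.
case: FY => -[_ _ Fface] _ Yx Yy Fxy; apply: contrapT => Fx.
by have [] := Fface x y (conj Yx Fx) Yy.
Qed.

Lemma refl_Y i x : Y x -> Y (refl i x).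
Proof.
move=> Yx; have sW : coxeter_group H L (reflection (H i) (L i)).
  by apply/coxeter_group_words; exists [:: i] => l; rewrite reflectionE.
by rewrite -(Yinv sW); exists x => //; rewrite reflectionE.
Qed.

(* A face is determined by any of its relative interior points, so that [s_i],
   which fixes [x], maps [F] to itself. *)
Lemma refl_face i x y : ri F x -> e i x = 0 -> F y -> F (refl i y).
Proof.
move=> xri x0 Fy.
have [eps eps0 /(_ eps)] := ri_subr Fcone face0 xri Fy.
rewrite lexx ltW// => /(_ isT) xy_ri; have Fxy := ri_sub xy_ri.
(* The fixed point [x] is the sum of the reflections of [eps *: y] and [x - eps *: y], both in [Y];
   a face contains the summands of its points. *)
have Feps : F (eps *: refl i y).
  apply: (@face_summand _ (refl i (x - eps *: y))).
  - exact/Ycone.2/refl_Y/F_sub.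
  - exact/refl_Y/F_sub.
  - by rewrite -linearZ -linearD addrC subrK /= refl_id//; exact: ri_sub.
by have := Fcone.2 _ _ (divr_gt0 ltr01 eps0) Feps; rewrite scalerA divfK ?gt_eqF// scale1r.
Qed.

Lemma upsilon_subP i : reflect (forall x, F x -> e i x = 0) (i \in upsilon_sub H L F).
Proof.
rewrite inE; apply: (iffP (asboolP _)) => Hi x Fx.
  by have := Hi x Fx; rewrite reflectionE => /(refl_idE ea).
by rewrite reflectionE refl_id// Hi.
Qed.

Lemma upsilonP i : (i \in upsilon H L F) <-> (forall x, F x -> F (refl i x)).
Proof.
rewrite inE; split=> [/asboolP E x Fx|Hi].
  by rewrite -E; exists x => //; rewrite reflectionE.
apply/asboolP/seteqP; split=> [_ [x Fx <-]|x Fx].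
  by rewrite reflectionE; exact: Hi.
by exists (refl i x); [exact: Hi | rewrite reflectionE reflK].
Qed.

End Faces.

End Translation.

Theorem theorem4p5 (R : realType) (h : vectType R) (n : nat)
    (H : 'I_n -> set h) (L : 'I_n -> set 'Hom(h, R^o))
    (lcs : linear_coxeter_system H L)
    (hh : 'I_n -> h) (alpha : 'I_n -> 'Hom(h, R^o))
    (hhH : forall i, H i (hh i)) (alphaL : forall i, L i (alpha i))
    (alpha_hh : forall i, alpha i (hh i) = 2)
    (Y : set 'Hom(h, R^o)) (YX : Y `<=` tits_cone H L)
    (Ycone : convex_cone Y) (Y0 : Y 0)
    (Yinv : forall s, coxeter_group H L s -> s @` Y = Y)
    (F : set 'Hom(h, R^o)) (FU : Upsilon H Y F) :
  let A := coxeter_mx hh alpha in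
  let D := [set J : {set 'I_n} |
              J \subset upsilon_sup H L F /\ fin_part A J = J] in
  let G (J : {set 'I_n}) :=
    ri F `&` facet hh (upsilon_sub H L F :|: J)%SET in
  [/\ ri F `&` closed_chamber H = \bigcup_(J in D) G J,
      trivIset D G,
      forall J, D J -> G J !=set0 &
      forall J, D J ->
        mid H L J @` ri (F `&` closed_chamber H) =
          mid H L J @` ri (F `&` closed_facet hh (upsilon_sub H L F)) /\
        mid H L J @` ri (F `&` closed_facet hh (upsilon_sub H L F)) = G J].
Proof.
move=> A D G.
case: FU => FY [x0 [x0ri x0C]].
have rd := lcs_root_datum lcs hhH alphaL alpha_hh.
have CE := closed_chamberE lcs hhH alpha_hh.
pose e i : {scalar 'Hom(h, R^o)} := evalh (hh i).
pose U0 := upsilon_sub H L F; pose Us := upsilon_sup H L F.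
have Fcone : convex_cone F by case: FY => -[].
have F0 : F 0 := face0 Y0 FY.
have FT : F `<=` in_tits_cone e alpha.
  by case: FY => -[_ FYs _] _ x /FYs/YX; exact: (tits_coneE lcs hhH alphaL alpha_hh).
have U0P i : reflect (forall x, F x -> e i x = 0) (i \in U0)
  by exact: (upsilon_subP lcs hhH alphaL alpha_hh).
have Us_disj i : i \in Us -> i \notin U0 by rewrite inE => /andP[].
have Us_refl i x : i \in Us -> F x -> F (simple_refl e alpha i x).
  by rewrite inE => /andP[_ /(upsilonP lcs hhH alphaL alpha_hh)]; apply.
have Us_ri i x : ri F x -> e i x = 0 -> i \notin U0 -> i \in Us.
  move=> xri xi iU; rewrite inE iU /=; apply/(upsilonP lcs hhH alphaL alpha_hh) => y.
  exact: (refl_face lcs hhH alphaL alpha_hh Ycone Y0 Yinv FY xri xi).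
have Aoff i j : i != j -> A i j <= 0.
  by move=> ij; rewrite mxE; exact: (cartan_offdiag_le0 rd).
have A_sym i j : A i j = 0 -> A j i = 0 by rewrite !mxE; exact: (cartan_eq0_sym rd).
have A2 i : A i i != 0 by rewrite mxE alpha_hh pnatr_eq0.
have finP (J : {set 'I_n}) := fin_partP J Aoff A_sym A2.
rewrite CE in x0C *.
(* The functionals indexed by [U0] vanish on [F], so the two sections agree even before taking
   relative interiors. *)
have secE : F `&` in_closed_chamber e = F `&` closed_facet hh U0.
  apply/seteqP; split=> x [Fx Cx]; split=> //.
    by split=> i iU; [have /U0P := iU; exact | exact: Cx].
  by move=> i; have [/Cx.1 xi|/Cx.2//] := boolP (i \in U0); rewrite /= /evalh xi.
have midE J : D J -> mid H L J @` ri (F `&` in_closed_chamber e) = G J.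
  move=> [JU /finP Jfin].
  have [ws [ws0 wsJ wsE]] := mid_words lcs hhH alphaL alpha_hh Jfin.
  rewrite (ri_chamber_section rd Fcone F0 FT U0P Us_refl Us_disj Us_ri x0ri x0C).
  apply: (mid_image rd Fcone F0 U0P Us_refl Us_disj JU Jfin ws0 wsJ wsE) => j x jJ.
    exact: (mid_refl lcs hhH alphaL alpha_hh Jfin).
  exact: (refl_mid lcs hhH alphaL alpha_hh Jfin).
split.
- apply/seteqP; split=> [x [xri xC]|x [J DJ [xri [xJ0 xJp]]]].
    have [J [JU Jfin xJ]] := ri_facet_finite_type rd Fcone F0 FT U0P Us_ri xri xC.
    by exists J => //; split => //; exact/finP.
  split=> // i; have [/xJ0 xi|/xJp/ltW//] := boolP (i \in U0 :|: J)%SET.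
  by rewrite /= /evalh xi.
- move=> J J' [JU _] [J'U _] [x [[_ [xJ0 xJp]] [_ [xJ'0 xJ'p]]]].
  (* The functionals vanishing at [x] determine [U0 :|: J], and [J] is its part outside [U0]. *)
  have UE i : (i \in U0 :|: J)%SET = (i \in U0 :|: J')%SET.
    apply/idP/idP => iJ; apply: contraT => iJ'.
      by have := xJ'p i iJ'; rewrite xJ0// ltxx.
    by have := xJp i iJ'; rewrite xJ'0// ltxx.
  apply/setP => i; have := UE i; rewrite !finset.in_setU.
  have [iU _|_] := boolP (i \in U0); last exact.
  have noU (K : {set 'I_n}) : K \subset Us -> (i \in K) = false.
    by move=> /fintype.subsetP KU; apply: contraTF iU => /KU/Us_disj.
  by rewrite !noU.
- move=> J DJ; rewrite -midE//.
  have [y yri yU] := facet_U0_exists rd Fcone F0 FT U0P Us_refl Us_disj Us_ri x0ri x0C.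
  rewrite (ri_chamber_section rd Fcone F0 FT U0P Us_refl Us_disj Us_ri x0ri x0C).
  by exists (mid H L J y), y.
- by move=> J DJ; rewrite -secE midE.
Qed.
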